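(* Let $\mathfrak G=(\mathfrak X,\mathfrak E)$ be a finite connected graph with at least one edge and without dead ends, with cyclomatic number $\mathfrak c(\mathfrak G)$. The spectral parameter $z=-1$ is exceptional. More precisely, we have the following. (1) If $\mathfrak c(\mathfrak G)\neq1$ or $\mathfrak G$ is not $2$-colorable, then $\dim_{\mathbb C}(\mathrm{im}(\mathcal P_{-1}|_{\mathcal D'(\widetilde\Omega)^{\Gamma,-1}}))=0$ and $$\dim_{\mathbb C}(\mathcal D'(\widetilde\Omega)^{\Gamma,-1})=\dim_{\mathbb C}\big(\mathcal E_{-1}(\Delta^{\mathrm e};\mathrm{Maps}(\mathfrak E,\mathbb C))\big)=\begin{cases}\mathfrak c(\mathfrak G)&\text{if }\mathfrak G\text{ is }2\text{-colorable},\\\mathfrak c(\mathfrak G)-1&\text{if }\mathfrak G\text{ is not }2\text{-colorable}.\end{cases}$$ (2) If $\mathfrak c(\mathfrak G)=1$ and $\mathfrak G$ is $2$-colorable, then $\dim_{\mathbb C}(\mathrm{im}(\mathcal P_{-1}|_{\mathcal D'(\widetilde\Omega)^{\Gamma,-1}}))=1$ and $$\dim_{\mathbb C}(\mathcal D'(\widetilde\Omega)^{\Gamma,-1})=\dim_{\mathbb C}\big(\mathcal E_{-1}(\Delta^{\mathrm e};\mathrm{Maps}(\mathfrak E,\mathbb C))\big)=2.$$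
   Context: Graphs: $\mathfrak X$ is the set of vertices and $\mathfrak E\subseteq\mathfrak X^2$ the set of directed edges, symmetric under $(a,b)\mapsto(b,a)$, without loops. For $\vec e=(a,b)$ put $\iota(\vec e)=a$, $\tau(\vec e)=b$, $\vec e^{\,\mathrm{op}}=(b,a)$. No dead ends: every directed edge starts an infinite non-backtracking chain of concatenated edges. The cyclomatic number is $\mathfrak c(\mathfrak G)=(\text{number of undirected edges})-|\mathfrak X|+1$. $2$-colorable means bipartite. Laplacians (on any such graph, finite or not, with finite vertex degrees): $q_x+1$ is the number of neighbors of $x$; $\Delta f(x)=\frac1{q_x+1}\sum_{\iota(\vec e)=x}f(\tau(\vec e))$; $\chi(z)(x)=\frac{z+q_xz^{-1}}{q_x+1}$ for $0\neq z\in\mathbb C$; $\mathcal E_{\chi(z)}(\Delta;\mathrm{Maps}(\mathfrak X,\mathbb C))=\{f\mid\Delta f(x)=\chi(z)(x)f(x)\ \forall x\}$. $\Delta^{\mathrm e}f(\vec e)=\sum_{\iota(\vec e\,')=\tau(\vec e),\ \vec e\,'\neq\vec e^{\,\mathrm{op}}}f(\vec e\,')$ and $\mathcal E_z(\Delta^{\mathrm e};\mathrm{Maps}(\mathfrak E,\mathbb C))=\{f\mid\Delta^{\mathrm e}f=zf\}$. Universal cover: $\widetilde{\mathfrak G}=(\widetilde{\mathfrak X},\widetilde{\mathfrak E})$ is the simply connected cover of the underlying undirected graph (each undirected edge replaced by two opposite directed ones), a tree with vertex Laplacian $\widetilde\Delta$ and corresponding function $\widetilde\chi(z)$; $\Gamma$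 is the group of deck transformations. $\widetilde\Omega$ is the boundary of $\widetilde{\mathfrak G}$: infinite non-backtracking vertex paths modulo sharing infinitely many vertices; $[x,\omega[$ is the representative of $\omega$ starting at $x$; $\partial_+\vec e$ is the set of $\omega$ such that $[\iota(\vec e),\omega[$ starts with $\vec e$; these sets generate the topology. $\mathcal D'(\widetilde\Omega)$ is the algebraic dual of the space of locally constant functions $\widetilde\Omega\to\mathbb C$ (finitely additive measures). Fix $o\in\widetilde{\mathfrak X}$; $\langle x,\omega\rangle=d(o,y)-d(x,y)$ where $[o,\omega[\,\cap\,[x,\omega[\,=[y,\omega[$. For $z\neq0$ the vertex Poisson transform is $\mathcal P_z\mu(x)=\int_{\widetilde\Omega}z^{\langle x,\omega\rangle}d\mu(\omega)$ for $\mu\in\mathcal D'(\widetilde\Omega)$, $x\in\widetilde{\mathfrak X}$; it maps $\mathcal D'(\widetilde\Omega)$ into $\mathcal E_{\widetilde\chi(z)}(\widetilde\Delta;\mathrm{Maps}(\widetilde{\mathfrak X},\mathbb C))$. The parameter $z\neq0$ is called exceptional if this map $\mathcal P_z:\mathcal D'(\widetilde\Omega)\to\mathcal E_{\widetilde\chi(z)}(\widetilde\Delta;\mathrm{Maps}(\widetilde{\mathfrak X},\mathbb C))$ is not bijective. Invariants: for an automorphism $g$ of $\widetilde{\mathfrak G}$, $\pi_z(g)\mu=g_*\big(z^{-\langle go,g\,\cdot\,\rangle}\mu\big)$ (multiply by the function $\omega\mapsto z^{-\langle go,g\omega\rangle}$, then push forward by $g$); $\mathcal D'(\widetilde\Omega)^{\Gamma,z}=\{\mu\mid\pi_z(\gamma)\mu=\mu\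 \forall\gamma\in\Gamma\}$. For $\mu\in\mathcal D'(\widetilde\Omega)^{\Gamma,z}$ the function $\mathcal P_z\mu$ is $\Gamma$-invariant and so is identified with a function on $\mathfrak X$, lying in $\mathcal E_{\chi(z)}(\Delta;\mathrm{Maps}(\mathfrak X,\mathbb C))$. *)

(* Defs.v *)
From HB Require Import structures.
From mathcomp Require Import all_boot all_order all_algebra finmap.
From mathcomp Require Import boolp classical_sets functions cardinality fsbigop.
From mathcomp Require Import reals topology.
From mathcomp Require Export complex.

Set Implicit Arguments.
Unset Strict Implicit.
Unset Printing Implicit Defensive.

Import GRing.Theory.

Local Open Scope classical_set_scope.
Local Open Scope ring_scope.

Section Dimension.
Context (K : fieldType) (V : lmodType K).

(* [A] is a linear subspace of dimension [n]: it has a basis of size [n]. *)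
Definition has_dim (A : set V) (n : nat) : Prop :=
  exists e : 'I_n -> V,
    (forall c : 'I_n -> K, \sum_(i < n) c i *: e i = 0 -> forall i, c i = 0) /\
    A = [set v | exists c : 'I_n -> K, v = \sum_(i < n) c i *: e i].

End Dimension.

Arguments has_dim K {V} A n.

(* Simple graphs, possibly infinite, with finite vertex degrees; the set of
   directed edges is [{(x, y) | y \in nbr x}]. *)
Record graph (V : choiceType) := Graph {
  nbr : V -> {fset V};
  nbr_sym : forall x y, (y \in nbr x) = (x \in nbr y);
  nbr_irr : forall x, x \notin nbr x }.

Section Graphs.
Context {V : choiceType} (G : graph V).

Definition adj : rel V := fun x y => y \in nbr G x.

Definition dedge := {e : V * V | e.2 \in nbr G e.1}.
Definition src (e : dedge) : V := (val e).1.
Definition tgt (e : dedge) : V := (val e).2.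

Definition walk (x y : V) (n : nat) : Prop :=
  exists p : seq V, [/\ path adj x p, last x p = y & size p = n].

Definition connected_graph : Prop := forall x y, exists n, walk x y n.

Definition acyclic : Prop :=
  forall c : seq V, uniq c -> cycle adj c -> (size c <= 2)%N.

Definition ray : set (nat -> V) :=
  [set s | forall n, s n.+1 \in nbr G (s n) /\ s n.+2 != s n].

Definition no_dead_ends : Prop :=
  forall e : dedge, exists s, [/\ ray s, s 0%N = src e & s 1%N = tgt e].

(* The value is meaningful when [x] and [y] are in the same component. *)
Definition dist (x y : V) : nat :=
  xget 0%N [set n | walk x y n /\ forall m, walk x y m -> (n <= m)%N].

(* A boundary point is an equivalence class of rays, as a set of rays. (The
   relation is an equivalence when [G] is a tree.) *)
Definition ray_class (s : nat -> V) : set (nat -> V) :=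
  [set t | ray t /\ infinite_set (range s `&` range t)].

Definition boundary : Type := set_type (ray_class @` ray).

End Graphs.

HB.instance Definition _ (V : choiceType) (G : graph V) :=
  SubChoice.copy (boundary G) (set_type (ray_class G @` ray G)).

Section Boundary.
Context {V : choiceType} (G : graph V).

(* The representative of [w] starting at [x], unique in a tree *)
Definition ray_to (x : V) (w : boundary G) : nat -> V :=
  xget (fun=> x) [set s | val w s /\ s 0%N = x].

Definition cylinder (e : dedge G) : set (boundary G) :=
  [set w | ray_to (src e) w 1%N = tgt e].

End Boundary.

HB.instance Definition _ (V : choiceType) (G : graph V) :=
  isSubBaseTopological.Build (boundary G) (range (@cylinder V G)) id.

Definition locally_constant {T : topologicalType} {U : Type} (f : T -> U) :
  Prop := forall w, \forall w' \near w, f w' = f w.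

Section LocallyConstantFunctions.
Context {V : choiceType} (G : graph V) (K : fieldType).

Definition lc_pred : {pred boundary G -> K^o} :=
  fun f => `[< locally_constant f >].

Lemma lc_submod_closed : submod_closed lc_pred.
Proof.
split=> [|a f g /asboolP lf /asboolP lg].
  by apply/asboolP => w; near=> w'.
apply/asboolP => w.
by apply: filterS2 (lf w) (lg w) => w' fw gw; rewrite !fctE fw gw.
Unshelve. all: by end_near.
Qed.

HB.instance Definition _ :=
  GRing.isSubmodClosed.Build K (boundary G -> K^o) lc_pred lc_submod_closed.

Definition lcfun : Type := {f : boundary G -> K^o | lc_pred f}.

HB.instance Definition _ := SubChoice.copy lcfun {f | lc_pred f}.
HB.instance Definition _ := [SubChoice_isSubLmodule of lcfun by <:].

End LocallyConstantFunctions.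

Section Poisson.
Context {V : choiceType} (G : graph V) (K : fieldType) (o : V).

(* [D'(Omega)], the linear functionals on the locally constant functions *)
Definition distributions : set (lcfun G K -> K^o) := [set mu | scalar mu].

(* [insubd] turns [f] into a locally constant function, with default value 0
   if [f] is not locally constant. When [G] is a tree, all functions integrated
   below are locally constant. *)
Definition integral (mu : lcfun G K -> K^o) (f : boundary G -> K^o) : K :=
  mu (insubd 0 f).

Definition confluence (x : V) (w : boundary G) : V :=
  xget x [set y | range (ray_to o w) `&` range (ray_to x w) =
                  range (ray_to y w)].

Definition horo (x : V) (w : boundary G) : int :=
  (dist G o (confluence x w))%:Z - (dist G x (confluence x w))%:Z.

Definition poisson (z : K) (mu : lcfun G K -> K^o) : V -> K^o :=
  fun x => integral mu (fun w => z ^ horo x w).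

End Poisson.

Arguments distributions {V} G K.

Section Laplacians.
Context {V : choiceType} (G : graph V) (K : fieldType).

Definition qdeg (x : V) : K := #|` nbr G x|%:R - 1.

Definition laplacian (f : V -> K^o) : V -> K^o :=
  fun x => (qdeg x + 1)^-1 * \sum_(y <- nbr G x) f y.

Definition chi (z : K) (x : V) : K := (z + qdeg x * z^-1) / (qdeg x + 1).

Definition eigen_vertex (z : K) : set (V -> K^o) :=
  [set f | forall x, laplacian f x = chi z x * f x].

Definition edge_laplacian (f : dedge G -> K^o) : dedge G -> K^o :=
  fun e => \sum_(e' \in [set e' : dedge G |
    src e' = tgt e /\ val e' <> (tgt e, src e)]) f e'.

Definition eigen_edge (z : K) : set (dedge G -> K^o) :=
  [set f | edge_laplacian f = z *: f].

(* The map [poisson o z] from [distributions G K] to [eigen_vertex z] (where it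
   takes its values when [G] is a tree without dead ends) is not bijective. *)
Definition exceptional (o : V) (z : K) : Prop :=
  z != 0 /\ ~ (set_inj (distributions G K) (poisson o z) /\
               set_surj (distributions G K) (eigen_vertex z) (poisson o z)).

End Laplacians.

Arguments eigen_vertex {V} G {K} z.
Arguments eigen_edge {V} G {K} z.
Arguments exceptional {V} G {K} o z.

Record automorphism (V : choiceType) (G : graph V) := Automorphism {
  aut_fun :> V -> V;
  aut_bij : bijective aut_fun;
  aut_nbr : forall x y, (aut_fun y \in nbr G (aut_fun x)) = (y \in nbr G x) }.

Section Action.
Context {V : choiceType} (G : graph V) (g : automorphism G).

Lemma aut_rayE s : ray G (g \o s) <-> ray G s.
Proof.
have ginj : injective g by apply: bij_inj (aut_bij g).
by split=> rs n; have := rs n; rewrite /= aut_nbr (inj_eq ginj).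
Qed.

Lemma aut_ray_class s :
  (fun t => g \o t) @` ray_class G s = ray_class G (g \o s).
Proof.
have [h gK hK] := aut_bij g.
have ginj : injective g by apply: can_inj gK.
have rangeE t : range (g \o s) `&` range (g \o t) =
                g @` (range s `&` range t).
  apply/seteqP; split=> [y [[n _ <-] [m _ /ginj e]]|_ [y [[n _ <-] [m _ e]] <-]].
    by exists (s n) => //; split; [exists n|exists m].
  by split; [exists n|exists m => //=; rewrite e].
apply/seteqP; split=> [_ [t [rt it] <-]|t [rt it]].
  split; first exact/aut_rayE.
  rewrite rangeE; apply: contra_not it => /(finite_image h).
  by rewrite image_comp; under eq_imagel do rewrite /= gK; rewrite image_id.
have te : t = g \o (h \o t) by apply/funext => n /=; rewrite hK.
rewrite te in rt it; exists (h \o t) => //; split; first exact/aut_rayE.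
by rewrite rangeE in it; apply: contra_not it => /(finite_image g).
Qed.

Lemma aut_boundary_subproof (w : boundary G) :
  (fun t => g \o t) @` val w \in ray_class G @` ray G.
Proof.
have := valP w; rewrite !inE => -[s rs <-].
by exists (g \o s); [exact/aut_rayE|rewrite aut_ray_class].
Qed.

Definition aut_boundary (w : boundary G) : boundary G :=
  exist (fun A => A \in ray_class G @` ray G) _ (aut_boundary_subproof w).

End Action.

Section Invariants.
Context {V : choiceType} (G : graph V) (K : fieldType) (o : V).

Definition dual_mul (h : boundary G -> K) (mu : lcfun G K -> K^o) :
  lcfun G K -> K^o := fun phi => integral mu (fun w => h w * val phi w).

Definition dual_push (g : automorphism G) (mu : lcfun G K -> K^o) :
  lcfun G K -> K^o := fun phi => integral mu (val phi \o aut_boundary g).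

Definition pi_rep (z : K) (g : automorphism G) (mu : lcfun G K -> K^o) :
  lcfun G K -> K^o :=
  dual_push g (dual_mul (fun w => z ^ (- horo o (g o) (aut_boundary g w))) mu).

Definition deck {X : Type} (p : V -> X) : set (automorphism G) :=
  [set g : automorphism G | p \o g = p].

Definition distributions_inv {X : Type} (p : V -> X) (z : K) :
  set (lcfun G K -> K^o) :=
  [set mu | distributions G K mu /\ forall g, deck p g -> pi_rep z g mu = mu].

End Invariants.

Arguments distributions_inv {V} G {K} o {X} p z.

(* Being simply connected means being a tree. *)
Definition universal_cover {V X : choiceType} (Gt : graph V) (G : graph X)
    (p : V -> X) : Prop :=
  [/\ connected_graph Gt, acyclic Gt, (forall a, exists x, p x = a) &
   forall x, {in nbr Gt x &, injective p} /\
             [fset p y | y in nbr Gt x]%fset = nbr G (p x)].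

Section FiniteGraphs.
Context {X : finType} (G : graph X).

Definition undirected_edges : {set {set X}} :=
  [set [set e.1; e.2]%SET | e : X * X & e.2 \in nbr G e.1]%SET.

(* For a connected nonempty graph the truncated subtraction is exact. *)
Definition cyclomatic : nat := (#|undirected_edges| + 1 - #|X|)%N.

Definition two_colorable : bool :=
  [exists c : {ffun X -> bool}, forall x, forall y,
     (y \in nbr G x) ==> (c x != c y)].

End FiniteGraphs.

(* Main.v *)
(* For z = -1 the integrand z^<x,w> of the Poisson transform does not depend on
   w: it is the sign sgn x of the 2-colouring of the tree with sgn o = 1, so that
   P_{-1} mu = mu(Omega) sgn. In particular P_{-1} is not injective.

   A distribution mu is determined by its values on the cylinders, and these can
   be prescribed by any function on edges that is additive under subdivision
   (Koenig's lemma: a locally constant function is constant on the cylinders of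
   a finite partition). Hence F(e) = sgn(src e) mu(cyl e) identifies the
   Gamma-invariant distributions with the eigenfunctions of the edge Laplacian
   on the finite graph, and mu(Omega) with the sum S(p o) of F over the edges
   starting at p o.

   The eigenvalue equation is F(b,a) - F(a,b) = S(b), whence S(b) = - S(a) along
   edges. So S = 0 if the graph is not bipartite, and S is a multiple of the
   2-colouring if it is; summing over all edges shows that the multiple is 0
   unless |X| = |U|, where U is the set of undirected edges. The solutions with
   S = 0 are the even functions in the kernel of the unsigned incidence matrix,
   whose rank is |X|, or |X| - 1 in the bipartite case. *)

From HB Require Import structures.
Require Import Defs.
From mathcomp Require Import all_boot all_order all_algebra finmap.
From mathcomp Require Import boolp classical_sets functions cardinality fsbigop.
From mathcomp Require Import reals topology.
From mathcomp Require Import ring zify.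

Set Implicit Arguments.
Unset Strict Implicit.
Unset Printing Implicit Defensive.

Import GRing.Theory.
Local Open Scope classical_set_scope.
Local Open Scope ring_scope.

(** * Reduced walks and rays in trees *)

Section ReducedWalks.
Context {V : choiceType} (G : graph V).
Implicit Types (x y a b : V) (l : seq V) (s t : nat -> V).

Lemma adj_sym x y : adj G x y = adj G y x.
Proof. by rewrite /adj nbr_sym. Qed.

Lemma adj_irr x : adj G x x = false.
Proof. exact/negbTE/nbr_irr. Qed.

Lemma edgeP a b : adj G a b -> exists e : dedge G, src e = a /\ tgt e = b.
Proof.
by move=> ab; exists (exist (fun e : V * V => e.2 \in nbr G e.1) (a, b) ab).
Qed.

Lemma src_tgt (e : dedge G) : adj G (src e) (tgt e).
Proof. exact: (valP e). Qed.

Fixpoint reduced l : bool :=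
  if l is a :: l' then
    (if l' is b :: l'' then adj G a b && (ohead l'' != Some a) else true)
    && reduced l'
  else true.

Lemma reduced_behead a l : reduced (a :: l) -> reduced l.
Proof. by case/andP. Qed.

Lemma reduced_path a l : reduced (a :: l) -> path (adj G) a l.
Proof. by elim: l a => //= b l IH a /andP[/andP[-> _] /IH]. Qed.

(** If the head recurred, the part of the walk up to the recurrence would be a cycle without
    repetition, so of length at most 2 by acyclicity: length 1 is a loop, length 2 a
    backtracking. *)
Lemma reduced_uniq : acyclic G -> forall l, reduced l -> uniq l.
Proof.
move=> Gac; elim=> // a l IH rl.
rewrite cons_uniq (IH (reduced_behead rl)) andbT; apply/negP => al.
have := reduced_path rl; have := IH (reduced_behead rl); move: rl.
case/splitPr: al => l1 l2 rl ul pl.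
have ul1 : uniq (a :: l1).
  move: ul; rewrite cat_uniq /= => /and3P[-> + _]; rewrite andbT.
  by case/norP.
have cl1 : cycle (adj G) (a :: l1).
  by move: pl; rewrite cat_path /= rcons_path => /and3P[-> ->].
have := Gac _ ul1 cl1.
case: l1 {ul ul1 pl} rl cl1 => [|b [|? ?]] //=; first by rewrite adj_irr.
by rewrite eqxx andbF.
Qed.

(** The walk runs back along [l1] to [a] and then out along [l2]; it does not backtrack at [a]
    because the two lists leave [a] differently. *)
Lemma reduced_catrev a l1 l2 : reduced (a :: l1) -> reduced (a :: l2) ->
  (ohead l1 == ohead l2) = false -> reduced (catrev l1 (a :: l2)).
Proof.
elim: l1 a l2 => [|b l1 IH] a l2 // r1 r2 e12 /=.
apply: IH; first exact: reduced_behead r1.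
  case/andP: r1 => /andP[ab _] _.
  by rewrite [reduced _]/= adj_sym ab eq_sym [_ == _]e12.
by case/andP: r1 => /andP[_ /negbTE].
Qed.

(** After the common initial part is removed, two diverging walks could be joined by
    [reduced_catrev] into a reduced walk meeting their common endpoint twice. *)
Lemma reduced_inj : acyclic G -> forall y l1 l2, reduced (y :: l1) ->
  reduced (y :: l2) -> last y l1 = last y l2 -> l1 = l2.
Proof.
move=> Gac y l1; elim: l1 y => [|b l1 IH] y [|c l2] // r1 r2 /=.
- move=> e; move: (reduced_uniq Gac r2); rewrite cons_uniq {1}e.
  by rewrite mem_last.
- move=> e; move: (reduced_uniq Gac r1); rewrite cons_uniq -{1}e.
  by rewrite mem_last.
have [bc|bc] := eqVneq b c => e.
  rewrite -bc in r2 e *.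
  by rewrite (IH b l2 (reduced_behead r1) (reduced_behead r2) e).
have bcF : (ohead (b :: l1) == ohead (c :: l2)) = false.
  by rewrite /= (inj_eq Some_inj) (negbTE bc).
have := reduced_uniq Gac (reduced_catrev r1 r2 bcF).
rewrite catrevE cat_uniq => /and3P[_ /hasPn/(_ (last b l1)) + _].
by rewrite mem_rev mem_last e in_cons mem_last orbT => /(_ isT).
Qed.

Hypotheses (Gconn : connected_graph G) (Gac : acyclic G).

(** Listed from [y] towards [x] and without [y], so that moving [y] along an edge only adds or
    removes the head of the list. *)
Definition geod x y : seq V :=
  xget [::] [set l | reduced (y :: l) /\ last y l = x].

(** A walk is made reduced by induction: when the step from [y] to [z] is undone at once, both steps
    are cancelled. *)
Lemma geodP x y : reduced (y :: geod x y) /\ last y (geod x y) = x.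
Proof.
rewrite /geod; apply: (@xgetPex _ _ [set l | reduced (y :: l) /\ last y l = x]).
have [n [w [+ + _]]] := Gconn y x.
elim: w y {n} => [|z w IH] y /= => [_ ->|/andP[yz pw] /(IH _ pw)[l [rl le]]].
  by exists [::].
case: (eqVneq (ohead l) (Some y)) => ly.
  case: l rl le ly => // a l /reduced_behead rl le [ay].
  by rewrite -ay; exists l.
by exists (z :: l); rewrite [reduced _]/= yz ly.
Qed.

Lemma geod_unique x y l : reduced (y :: l) -> last y l = x -> geod x y = l.
Proof.
have [r e] := geodP x y; move=> rl el.
by apply: reduced_inj rl _; rewrite ?e ?el.
Qed.

Lemma geodxx x : geod x x = [::].
Proof. exact: geod_unique. Qed.

Lemma geod_adj x y y' : adj G y y' ->
  geod x y' = y :: geod x y \/ geod x y = y' :: geod x y'.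
Proof.
move=> yy'; have [r e] := geodP x y.
case: (eqVneq (ohead (geod x y)) (Some y')) => oh.
  case: (geod x y) oh r e => // ? l [->] /reduced_behead r e.
  by right; rewrite (geod_unique r e).
by left; apply: geod_unique; rewrite // [reduced _]/= adj_sym yy' oh.
Qed.

Definition parity x y : bool := odd (size (geod x y)).

Lemma parity_adj x y y' : adj G y y' -> parity x y' = ~~ parity x y.
Proof.
move=> yy'; rewrite /parity.
by case: (geod_adj x yy') => -> /=; rewrite ?negbK.
Qed.

Lemma parity_walk o x y n : walk G x y n -> odd n = parity o x (+) parity o y.
Proof.
move=> [w [+ + <-]]; elim: w x {n} => [x _ /= <-|z w IH x /= /andP[xz pw] e].
  by rewrite addbb.
by rewrite (IH _ pw e) (parity_adj o xz) -addNb negbK.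
Qed.

Lemma parity_dist o x y : odd (dist G x y) = parity o x (+) parity o y.
Proof.
apply: parity_walk; rewrite /dist.
have ex : exists n, `[< walk G x y n >].
  by have [n ?] := Gconn x y; exists n; apply/asboolP.
case: (ex_minnP ex) => n /asboolP wn nmin.
set A := [set n | _]; have An : A n by split=> // m wm; exact/nmin/asboolP.
by have [] := xgetI 0%N An.
Qed.

End ReducedWalks.

(** * Rays in a tree and their asymptotic classes *)

Section Rays.
Context {V : choiceType} (G : graph V).
Hypotheses (Gconn : connected_graph G) (Gac : acyclic G).
Implicit Types (x y a b : V) (l : seq V) (s t : nat -> V).

Definition shift n s : nat -> V := fun k => s (n + k)%N.

Definition ray_cons x s : nat -> V := fun n => if n is k.+1 then s k else x.

Lemma ray_shift n s : ray G s -> ray G (shift n s).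
Proof. by move=> rs k; rewrite /shift !addnS. Qed.

Lemma ray_ray_cons x s : adj G x (s 0%N) -> s 1%N != x -> ray G s ->
  ray G (ray_cons x s).
Proof. by move=> xs sx rs [|n] //=. Qed.

Lemma ray_reduced s n : ray G s -> reduced G (mkseq s n).
Proof.
elim: n s => // n IH s rs.
have -> : mkseq s n.+1 = s 0%N :: mkseq (shift 1 s) n.
  by rewrite /mkseq /= -[1%N]addn0 iotaDl -map_comp.
rewrite /= (IH _ (ray_shift 1 rs)) andbT.
case: n {IH} => [|[|n]] //=; rewrite /adj ?(rs 0%N).1 //.
by rewrite andTb (inj_eq Some_inj); have [_] := rs 0%N.
Qed.

(** Initial segments of the two rays are reduced walks with the same ends, hence equal. *)
Lemma ray_meet s t m n : ray G s -> ray G t -> s 0%N = t 0%N -> s m = t n ->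
  m = n /\ forall i, (i <= m)%N -> s i = t i.
Proof.
move=> rs rt e0 e.
have dec (u : nat -> V) k : mkseq u k.+1 = u 0%N :: behead (mkseq u k.+1) by [].
have lst (u : nat -> V) k : last (u 0%N) (behead (mkseq u k.+1)) = u k.
  by rewrite -[LHS]/(last (u 0%N) (mkseq u k.+1)) mkseqS last_rcons.
have E : mkseq s m.+1 = mkseq t n.+1.
  rewrite (dec s) (dec t) e0; congr cons.
  apply: (reduced_inj Gac (y := t 0%N)).
  - by rewrite -e0 -dec; exact: ray_reduced.
  - by rewrite -dec; exact: ray_reduced.
  - by rewrite -[in LHS]e0 !lst.
have mn : m = n by have := congr1 size E; rewrite !size_mkseq => -[].
split=> // i im; have := congr1 (fun l => nth (s 0%N) l i) E.
by rewrite !nth_mkseq // -mn.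
Qed.

Lemma ray_inj s : ray G s -> injective s.
Proof. by move=> rs m n e; have [] := ray_meet rs rs erefl e. Qed.

(** Having a common tail; [asymptoticP] identifies this with the relation behind [ray_class]. *)
Definition asymptotic s t := exists m n, shift m s = shift n t.

Lemma asymptotic_sym s t : asymptotic s t -> asymptotic t s.
Proof. by case=> m [n e]; exists n, m. Qed.

Lemma shift_shift m n s : shift m (shift n s) = shift (n + m) s.
Proof. by apply/funext => k; rewrite /shift addnA. Qed.

Lemma asymptotic_trans s t u : asymptotic s t -> asymptotic t u ->
  asymptotic s u.
Proof.
move=> [m [n e]] [m' [n' e']]; exists (m + m')%N, (n' + n)%N.
by rewrite -!shift_shift e -e' !shift_shift addnC.
Qed.

Lemma asymptotic_eq s t : ray G s -> ray G t -> s 0%N = t 0%N ->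
  asymptotic s t -> s = t.
Proof.
move=> rs rt e0 [m [n e]]; apply/funext => i.
have ei : s (m + i)%N = t (n + i)%N by exact: (congr1 (@^~ i) e).
by have [_ ->] := ray_meet rs rt e0 ei; rewrite ?leq_addl.
Qed.

Lemma asymptoticP s t : ray G s -> ray G t ->
  infinite_set (range s `&` range t) <-> asymptotic s t.
Proof.
move=> rs rt; split=> [inf|[m [n e]]].
  (* Up to time [M] the rays visit only finitely many vertices, so an infinite intersection gives a
     meeting later than [M] on both rays. *)
  have far M : exists m n, [/\ (M < m)%N, (M < n)%N & s m = t n].
    apply: contra_notP inf => far.
    apply: (@sub_finite_set _ _ (s @` `I_M.+1 `|` t @` `I_M.+1)).
      move=> _ [[m _ <-] [n _ e]].
      case: (ltnP M m) => mM; last by left; exists m.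
      case: (ltnP M n) => nM; last by right; exists n.
      by exfalso; apply: far; exists m, n.
    by rewrite finite_setU; split; apply: finite_image; apply: finite_II.
  (* One meeting is fixed; between it and arbitrarily late ones [ray_meet] forces the two tails to
     agree. *)
  have [m [n [_ _ emn]]] := far 0%N; exists m, n; apply/funext => k.
  have [m' [n' [lm ln e]]] := far (m + n + k)%N.
  have lem : (m + k <= m')%N.
    by apply: leq_trans (ltnW lm); rewrite addnAC leq_addr.
  have len : (n <= n')%N.
    by apply: leq_trans (ltnW ln); rewrite addnAC leq_addl.
  have [] := @ray_meet (shift m s) (shift n t) (m' - m) (n' - n)
    (ray_shift m rs) (ray_shift n rt).
  - by rewrite /shift !addn0.
  - by rewrite /shift !subnKC // (leq_trans _ lem) ?leq_addr.
  by move=> _; apply; rewrite leq_subRL // (leq_trans _ lem) ?leq_addr.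
apply: (@sub_infinite_set _ (shift m s @` [set: nat])).
  move=> _ [k _ <-]; split; first by exists (m + k)%N.
  by rewrite e; exists (n + k)%N.
move=> /(@finite_preimage _ _ _ (shift m s)) fin; apply: infinite_nat.
apply: sub_finite_set (fin _) => [k _|k l _ _]; first by exists k.
exact: (ray_inj (ray_shift m rs)).
Qed.

End Rays.

(** * The boundary of a tree *)

Section RayConstruction.
Context {V : choiceType} (G : graph V).
Implicit Types (a b c x y : V) (s : nat -> V).

(** Dependent choice: [next] replaces a directed edge by a chosen continuation, and the ray lists
    the sources of its iterates. *)
Lemma ray_of_steps (Q : V -> V -> Prop) :
  (forall a b, adj G a b -> Q a b -> exists c, [/\ adj G b c, c != a & Q b c]) ->
  forall a b, adj G a b -> Q a b ->
  exists s, [/\ ray G s, s 0%N = a, s 1%N = b & forall n, Q (s n) (s n.+1)].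
Proof.
move=> step a b ab Qab.
pose A (e : V * V) := [set c | [/\ adj G e.2 c, c != e.1 & Q e.2 c]].
pose next e := (e.2, xget e.2 (A e)).
have inv n : let e := iter n next (a, b) in adj G e.1 e.2 /\ Q e.1 e.2.
  elim: n => //= n [e1 e2]; have [c Ac] := step _ _ e1 e2.
  by have [] := xgetI (iter n next (a, b)).2 (Ac : A (iter n next (a, b)) c).
exists (fun n => (iter n next (a, b)).1); split=> // n; last exact: (inv n).2.
have [e1 e2] := inv n; have [c Ac] := step _ _ e1 e2; split=> //=.
by have [] := xgetI (iter n next (a, b)).2 (Ac : A (iter n next (a, b)) c).
Qed.

(** The bar of Koenig's lemma in inductive form: it permits induction over the well-founded tree of
    continuations cut off where [P] holds. *)
Inductive barred (P : V -> V -> Prop) a b : Prop :=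
| Barred_now of P a b
| Barred_later of forall c, adj G b c -> c != a -> barred P b c.

(** An edge that is not barred has a continuation that is not barred, so repeated choice would give
    a ray that never satisfies [P]. *)
Lemma ray_barred (P : V -> V -> Prop) :
  (forall s, ray G s -> exists n, P (s n) (s n.+1)) ->
  forall a b, adj G a b -> barred P a b.
Proof.
move=> rayP a b ab; apply: contrapT => nb.
have [|s [/rayP[n Pn] _ _ /(_ n)]] :=
  @ray_of_steps (fun a b => ~ barred P a b) _ a b ab nb.
  move=> {a b ab nb} a b ab nb; apply: contra_notP nb => nex.
  apply: Barred_later => c bc ca; apply: contrapT => nc.
  by apply: nex; exists c.
by apply; exact: Barred_now.
Qed.

End RayConstruction.

Section Boundary.
Context {V : choiceType} (G : graph V).
Hypotheses (Gconn : connected_graph G) (Gac : acyclic G).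
Implicit Types (a b c x y : V) (s t : nat -> V) (w : boundary G).

Lemma boundary_ray w s : val w s -> ray G s.
Proof. by have := valP w; rewrite inE => -[r rr <-] []. Qed.

Lemma mem_boundary w s t : val w s -> ray G t -> val w t <-> asymptotic s t.
Proof.
move=> ws rt; have rs := boundary_ray ws.
have := valP w; rewrite inE => -[r rr er]; move: ws; rewrite -er => -[_].
rewrite (asymptoticP Gac rr rs) => ers; split=> [[_]|est].
  rewrite (asymptoticP Gac rr rt) => ert.
  exact: asymptotic_trans (asymptotic_sym ers) ert.
by split=> //; rewrite (asymptoticP Gac rr rt); apply: asymptotic_trans est.
Qed.

Lemma ray_boundary s : ray G s -> exists w, val w s.
Proof.
move=> rs; have sA : ray_class G s \in ray_class G @` ray G.
  by rewrite inE; exists s.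
exists (exist (fun A => A \in ray_class G @` ray G) _ sA); split=> //.
rewrite (asymptoticP Gac rs rs).
by exists 0%N, 0%N.
Qed.

Lemma boundary_shift w s n : val w s -> val w (shift n s).
Proof.
move=> ws; apply/(mem_boundary ws); first exact/ray_shift/boundary_ray/ws.
by exists n, 0%N.
Qed.

Lemma boundary_cons w s x : val w s -> adj G x (s 0%N) -> s 1%N != x ->
  val w (ray_cons x s).
Proof.
move=> ws xs sx; apply/(mem_boundary ws); last by exists 0%N, 1%N.
exact: ray_ray_cons xs sx (boundary_ray ws).
Qed.

(** A ray of the class is carried along a walk to [x]: each step drops the first vertex of the ray
    if the ray runs through the new vertex, and prepends the new vertex otherwise. *)
Lemma ray_toP x w : val w (ray_to x w) /\ ray_to x w 0%N = x.
Proof.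
apply: (@xgetPex _ _ [set s | val w s /\ s 0%N = x]).
have [r wr] : exists r, val w r.
  have := valP w; rewrite inE => -[r rr er]; exists r; rewrite -er; split=> //.
  by apply/(asymptoticP Gac rr rr); exists 0%N, 0%N.
have [n [p [+ + _]]] := Gconn x (r 0%N).
elim: p x {n} => [|y p IH] x /= => [_ ->|/andP[xy pp] /(IH _ pp)[s [ws s0]]].
  by exists r.
have [s1|s1] := eqVneq (s 1%N) x.
  by exists (shift 1 s); split=> //; exact: boundary_shift.
by exists (ray_cons x s); split=> //; apply: boundary_cons; rewrite ?s0.
Qed.

Lemma ray_to0 x w : ray_to x w 0%N = x.
Proof. exact: (ray_toP x w).2. Qed.

Lemma ray_to_ray x w : ray G (ray_to x w).
Proof. exact: boundary_ray (ray_toP x w).1. Qed.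

Lemma ray_to_unique x w s : val w s -> s 0%N = x -> ray_to x w = s.
Proof.
move=> ws s0; have [wr r0] := ray_toP x w.
apply: (asymptotic_eq Gac) => //; last 1 first.
- exact/(mem_boundary wr)/ws/boundary_ray/ws.
- exact: ray_to_ray.
- exact: boundary_ray ws.
by rewrite r0.
Qed.

Lemma ray_to_shift x w n : ray_to (ray_to x w n) w = shift n (ray_to x w).
Proof.
apply: ray_to_unique; last by rewrite /shift addn0.
exact/boundary_shift/(ray_toP x w).1.
Qed.

Lemma ray_to_adj x w : adj G x (ray_to x w 1%N).
Proof. by have [] := ray_to_ray x w 0%N; rewrite ray_to0. Qed.

Definition cyl a b : set (boundary G) := [set w | ray_to a w 1%N = b].

(** Removing an edge of a tree splits the boundary in two: if the ray from [a] does not start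
    towards [b], prepending [b] gives the ray from [b]. *)
Lemma cylC a b : adj G a b -> cyl b a = ~` cyl a b.
Proof.
move=> ab; apply/seteqP; split=> w; rewrite /cyl /=.
  move=> ba /= ab'; have := ray_to_shift b w 1; rewrite ba => e.
  have [_] := ray_to_ray b w 0%N; rewrite ray_to0.
  by rewrite -{2}ab' e /shift eqxx.
move=> nab; have [wr r0] := ray_toP a w.
rewrite (@ray_to_unique b w (ray_cons b (ray_to a w))) //.
by apply: boundary_cons => //; [rewrite r0 adj_sym|exact/eqP].
Qed.

Lemma cyl_step a b c : adj G a b -> c != a -> cyl b c `<=` cyl a b.
Proof.
move=> ab ca w wbc; rewrite adj_sym in ab; rewrite (cylC ab).
by move=> wba; move: ca; rewrite -wbc wba eqxx.
Qed.

Lemma cyl_ray s n : ray G s -> cyl (s n) (s n.+1) `<=` cyl (s 0%N) (s 1%N).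
Proof.
move=> rs; elim: n => // n IH; apply: subset_trans IH; apply: cyl_step.
  exact: (rs n).1.
exact: (rs n).2.
Qed.

(** A ray to [w] finally runs along the ray from [a], and cylinders shrink along that ray. *)
Lemma cyl_tail s w a b : val w s -> cyl a b w ->
  exists N, forall n, (N <= n)%N -> cyl (s n) (s n.+1) `<=` cyl a b.
Proof.
move=> ws wab; have [wr r0] := ray_toP a w.
have [m [l e]] := (mem_boundary wr (boundary_ray ws)).1 ws.
exists l => n ln; rewrite -(subnKC ln).
have -> i : s (l + i)%N = ray_to a w (m + i)%N by exact/esym/(congr1 (@^~ i) e).
rewrite -addnS; have -> i : s (l + i)%N = ray_to a w (m + i)%N.
  exact/esym/(congr1 (@^~ i) e).
rewrite addnS; apply: subset_trans (cyl_ray (ray_to_ray a w)) _.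
by rewrite ray_to0 wab.
Qed.

Lemma cylinder_cyl (e : dedge G) : cylinder e = cyl (src e) (tgt e).
Proof. by []. Qed.

Lemma cyl_open a b : adj G a b -> open (cyl a b).
Proof.
move=> ab; have [e [se te]] := edgeP ab.
exists [set cyl a b]; last by rewrite bigcup_set1.
move=> _ ->; exists [fset cyl a b]%fset.
  by move=> _ /fset1P ->; rewrite inE; exists e; rewrite // /cylinder se te.
apply/seteqP; split=> [w|w wab _ /fset1P -> //].
by move/(_ (cyl a b)); apply; rewrite /= inE.
Qed.

(** A basic neighbourhood of the end of the ray is a finite intersection of cylinders, each of which
    contains all sufficiently late cylinders along the ray. *)
Lemma locally_constant_ray (U : Type) (phi : boundary G -> U) s :
  locally_constant phi -> ray G s ->
  exists n v, forall w, cyl (s n) (s n.+1) w -> phi w = v.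
Proof.
move=> lphi rs; have [w ws] := ray_boundary rs.
have : nbhs w [set w' | phi w' = phi w] := lphi w.
rewrite nbhsE => -[B [Bo Bw] BA].
case: Bo Bw BA => D sD <- [A DA Aw] sA.
have [F sF eA] := sD _ DA.
have ev i : i \in F -> \oo [set n | cyl (s n) (s n.+1) `<=` i].
  move=> iF; have := sF _ iF; rewrite inE => -[e _ ei].
  have ew : cyl (src e) (tgt e) w.
    have : (\bigcap_(i in [set` F]) id i) w by rewrite eA; exact: Aw.
    by move=> /(_ _ iF); rewrite -ei.
  have [N sN] := cyl_tail ws ew; exists N => // n /= /sN.
  by rewrite -cylinder_cyl ei.
have [N _ /(_ N (leqnn N)) sN] := filter_bigI _ ev.
exists N, (phi w) => w' w'N; apply: sA; exists A => //.
have : (\bigcap_(i in [set` F]) id i) w' by move=> i iF; exact: sN.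
by rewrite eA.
Qed.

End Boundary.

(** * Distributions on the boundary *)

Section LocallyConstant.
Context {V : choiceType} (G : graph V) (K : fieldType).
Implicit Types (f g : boundary G -> K^o) (phi psi : lcfun G K).

Lemma lcfun_eq phi psi : (forall w, val phi w = val psi w) -> phi = psi.
Proof. by move=> e; apply/val_inj/funext. Qed.

Lemma lcfun_sumE (I : Type) (r : seq I) (P : pred I) (F : I -> lcfun G K) w :
  val (\sum_(i <- r | P i) F i) w = \sum_(i <- r | P i) val (F i) w.
Proof. by rewrite raddf_sum /= fct_sumE. Qed.

Definition lcf f : lcfun G K := insubd 0 f.

Lemma lcfE f : locally_constant f -> val (lcf f) = f.
Proof. by move=> lf; rewrite /lcf insubdK //; apply/asboolP. Qed.

Lemma locally_constant_val phi : locally_constant (val phi).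
Proof. exact/asboolP/(valP phi). Qed.

Lemma lcf_val phi : lcf (val phi) = phi.
Proof. exact/val_inj/lcfE/locally_constant_val. Qed.

Lemma locally_constant_cst (v : K) : locally_constant (fun _ : boundary G => v).
Proof. by move=> w; apply: filterE. Qed.

Lemma locally_constantM f g : locally_constant f -> locally_constant g ->
  locally_constant (fun w => f w * g w : K^o).
Proof. by move=> lf lg w; apply: filterS2 (lf w) (lg w) => w' -> ->. Qed.

Section Distributions.
Context (mu : lcfun G K -> K^o) (mu_dist : distributions G K mu).

Lemma distributionZ v phi : mu (v *: phi) = v * mu phi.
Proof.
have mu0 : mu 0 = 0.
  by have := mu_dist (-1) 0 0; rewrite scaler0 addr0 /= mulN1r addNr.
by have := mu_dist v phi 0; rewrite !addr0 mu0 addr0.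
Qed.

Lemma distribution0 : mu 0 = 0.
Proof. by rewrite -(scale0r 0) distributionZ mul0r. Qed.

Lemma distributionD phi psi : mu (phi + psi) = mu phi + mu psi.
Proof. by have := mu_dist 1 phi psi; rewrite scale1r /= mul1r. Qed.

Lemma distribution_sum (I : Type) (r : seq I) (P : pred I)
    (F : I -> lcfun G K) :
  mu (\sum_(i <- r | P i) F i) = \sum_(i <- r | P i) mu (F i).
Proof. exact: (big_morph _ distributionD distribution0). Qed.

End Distributions.

End LocallyConstant.

(** * Distributions as additive functions on cylinders *)

Section CylinderDecomposition.
Context {V : choiceType} (G : graph V) (K : fieldType).
Hypotheses (Gconn : connected_graph G) (Gac : acyclic G).
Implicit Types (a b c x y : V) (s t : nat -> V) (w : boundary G).
Implicit Types (phi : lcfun G K) (mu nu : lcfun G K -> K^o).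

Lemma locally_constant_cyl a b : adj G a b ->
  locally_constant (fun w : boundary G => (ray_to a w 1%N == b)%:R : K).
Proof.
move=> ab w; have [wab|wab] := eqVneq (ray_to a w 1%N) b.
  have : nbhs w (cyl a b) by apply: open_nbhs_nbhs; split=> //; exact: cyl_open.
  by apply: filterS => w' /= ->; rewrite eqxx.
have ba : adj G b a by rewrite adj_sym.
have : nbhs w (cyl b a).
  apply: open_nbhs_nbhs; split; first exact: cyl_open.
  by rewrite (cylC Gconn Gac ab); exact/eqP.
rewrite (cylC Gconn Gac ab); apply: filterS => w' /= /eqP.
by rewrite -[_ == b]/(_ == _) => /negbTE ->.
Qed.

Definition restr phi a b : lcfun G K :=
  lcf (fun w => val phi w * (ray_to a w 1%N == b)%:R).

Lemma restrE phi a b w : adj G a b ->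
  val (restr phi a b) w = val phi w * (ray_to a w 1%N == b)%:R.
Proof.
move=> ab; rewrite lcfE //; apply: locally_constantM (locally_constant_cyl ab).
exact: locally_constant_val.
Qed.

Definition one_lc : lcfun G K := lcf (fun=> 1).

Lemma one_lcE w : val one_lc w = 1.
Proof. by rewrite lcfE //; exact: locally_constant_cst. Qed.

Definition ind a b := restr one_lc a b.

Lemma indE a b w : adj G a b -> val (ind a b) w = (ray_to a w 1%N == b)%:R.
Proof. by move=> ab; rewrite restrE // one_lcE mul1r. Qed.

Lemma sum_nbr_delta a w (P : pred V) (v : K) :
  \sum_(c <- nbr G a | P c) v * (ray_to a w 1%N == c)%:R =
  v * (P (ray_to a w 1%N))%:R.
Proof.
rewrite big_mkcond (bigD1_seq (ray_to a w 1%N)) ?fset_uniq //=; last first.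
  exact: ray_to_adj.
rewrite eqxx big1 ?addr0 => [|c /negbTE]; first by case: ifP; rewrite ?mulr0.
by rewrite eq_sym => ->; rewrite mulr0 if_same.
Qed.

(** A boundary point lies beyond the edge from [a] to [b] exactly when its ray from [b] does not
    start towards [a]. *)
Lemma restr_split phi a b : adj G a b ->
  restr phi a b = \sum_(c <- nbr G b | c != a) restr phi b c.
Proof.
move=> ab; apply: lcfun_eq => w; rewrite lcfun_sumE restrE // big_seq_cond.
under eq_bigr => c /andP[bc _] do rewrite restrE //.
rewrite -big_seq_cond (sum_nbr_delta _ _ (fun c => c != a)).
congr (_ * (nat_of_bool _)%:R).
have := cylC Gconn Gac ab => /(congr1 (@^~ w)); rewrite /cyl /setC /= => e.
apply/idP/idP => [/eqP wab|]; first by apply/eqP; rewrite e.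
by apply: contraNT => /eqP wab; apply/eqP; rewrite e.
Qed.

Lemma restr_total phi a : phi = \sum_(b <- nbr G a) restr phi a b.
Proof.
apply: lcfun_eq => w; rewrite lcfun_sumE big_seq_cond.
under eq_bigr => c /andP[bc _] do rewrite restrE //.
by rewrite -big_seq_cond (sum_nbr_delta _ _ xpredT) mulr1.
Qed.

Lemma restr_cst phi a b (v : K) : adj G a b ->
  (forall w, cyl a b w -> val phi w = v) -> restr phi a b = v *: ind a b.
Proof.
move=> ab phiv; apply: lcfun_eq => w; rewrite restrE //.
have -> : val (v *: ind a b) w = v * val (ind a b) w by [].
rewrite indE //; case: eqVneq => [wab|_]; last by rewrite !mulr0.
by rewrite (phiv w wab).
Qed.

Lemma barred_constant phi a b : adj G a b ->
  barred G (fun a b => exists v, forall w, cyl a b w -> val phi w = v) a b.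
Proof.
apply: ray_barred => s /(locally_constant_ray Gconn Gac).
by apply; exact: locally_constant_val.
Qed.

(** Bar induction: where [phi] is constant its restriction is a multiple of an indicator, and
    elsewhere [restr_split] passes to the continuations. *)
Lemma distributions_eq (o : V) mu nu :
  distributions G K mu -> distributions G K nu ->
  (forall a b, adj G a b -> mu (ind a b) = nu (ind a b)) -> mu = nu.
Proof.
move=> dmu dnu e; apply/funext => phi.
have er a b : adj G a b -> mu (restr phi a b) = nu (restr phi a b).
  move=> ab; have bar := barred_constant phi ab; elim: bar ab => {}a {}b.
    by move=> [v phiv] ab; rewrite (restr_cst ab phiv) !distributionZ // e.
  move=> _ IH ab; rewrite restr_split // !distribution_sum // big_seq_cond.
  by rewrite [RHS]big_seq_cond; apply: eq_bigr => c /andP[bc ca]; exact: IH.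
rewrite (restr_total phi o) !distribution_sum // big_seq [RHS]big_seq.
by apply: eq_bigr => b; exact: er.
Qed.

Section Extension.
Context (m : V -> V -> K).
Hypothesis m_additive : forall a b, adj G a b ->
  m a b = \sum_(c <- nbr G b | c != a) m b c.
Context (pt : V -> V -> boundary G).
Hypothesis pt_cyl : forall a b, adj G a b -> cyl a b (pt a b).

(* The Riemann sum of [phi] over the cylinders [n] steps beyond [(a, b)], with
   sample points [pt]; it is eventually constant in [n]. *)
Fixpoint level n (phi : boundary G -> K^o) a b : K :=
  if n is n'.+1 then \sum_(c <- nbr G b | c != a) level n' phi b c
  else phi (pt a b) * m a b.

Lemma level_linear n v (phi psi : lcfun G K) a b :
  level n (val (v *: phi + psi)) a b =
  v * level n (val phi) a b + level n (val psi) a b.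
Proof.
elim: n a b => [|n IH] a b /=; first by rewrite fctE mulrDl mulrA.
by under eq_bigr do rewrite IH; rewrite big_split mulr_sumr.
Qed.

Lemma level_cst n (phi : boundary G -> K^o) a b v : adj G a b ->
  (forall w, cyl a b w -> phi w = v) -> level n phi a b = v * m a b.
Proof.
elim: n a b => [|n IH] a b ab phiv /=; first by rewrite (phiv _ (pt_cyl ab)).
rewrite m_additive // mulr_sumr big_seq_cond [RHS]big_seq_cond.
apply: eq_bigr => c /andP[bc ca]; apply: IH => // w wbc.
exact/phiv/(cyl_step Gconn Gac ab ca).
Qed.

Definition level_lim (phi : lcfun G K) a b : K :=
  xget 0 [set v | \forall n \near \oo, level n (val phi) a b = v].

Lemma level_limE (phi : lcfun G K) a b v :
  (\forall n \near \oo, level n (val phi) a b = v) -> level_lim phi a b = v.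
Proof.
move=> ev; have := xgetI 0 (ev : [set v | \forall n \near \oo, _ = v] v).
rewrite -/(level_lim _ _ _) /= => ev'.
by have [n [/= <-]] := filter_ex (filterI ev' ev).
Qed.

(** Bar induction again: the sums do not depend on [n] where [phi] is constant, and finitely many
    continuations stabilise together. *)
Lemma level_near (phi : lcfun G K) a b : adj G a b ->
  \forall n \near \oo, level n (val phi) a b = level_lim phi a b.
Proof.
move=> ab.
suff [v ev] : exists v, \forall n \near \oo, level n (val phi) a b = v.
  by rewrite (level_limE ev).
have bar := barred_constant phi ab; elim: bar ab => {}a {}b.
  move=> [v phiv] ab; exists (v * m a b).
  by apply: filterE => n; exact: level_cst.
move=> _ IH ab.
have ev c : c \in [fset c in nbr G b | c != a]%fset ->
    \oo [set n | level n (val phi) b c = level_lim phi b c].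
  rewrite !inE => /andP[bc ca]; have [v ev] := IH c bc ca bc.
  by rewrite (level_limE ev).
exists (\sum_(c <- nbr G b | c != a) level_lim phi b c).
have [N _ eN] := filter_bigI _ ev.
(* One level is spent on passing from the edge to its continuations. *)
exists N.+1 => // -[//|n] /= /eN lev; rewrite big_seq_cond [RHS]big_seq_cond.
by apply: eq_bigr => c bc; apply: lev; rewrite /= !inE.
Qed.

Lemma level_lim_linear v (phi psi : lcfun G K) a b : adj G a b ->
  level_lim (v *: phi + psi) a b = v * level_lim phi a b + level_lim psi a b.
Proof.
move=> ab; apply: level_limE.
apply: filterS2 (level_near phi ab) (level_near psi ab) => n.
by rewrite level_linear => -> ->.
Qed.

Lemma level_lim_split (phi : lcfun G K) a b : adj G a b ->
  level_lim phi a b = \sum_(c <- nbr G b | c != a) level_lim phi b c.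
Proof.
move=> ab.
have ev c : c \in nbr G b ->
    \oo [set n | level n (val phi) b c = level_lim phi b c].
  exact: level_near.
apply: level_limE; have [N _ eN] := filter_bigI _ ev.
exists N.+1 => // -[//|n] /= /eN lev; rewrite big_seq_cond [RHS]big_seq_cond.
by apply: eq_bigr => c /andP[bc _]; exact: lev.
Qed.

Definition level_total (phi : lcfun G K) a : K :=
  \sum_(b <- nbr G a) level_lim phi a b.

(** At both ends of an edge the total is the sum of the masses of the two opposite cylinders;
    connectedness does the rest. *)
Lemma level_total_base (phi : lcfun G K) x y :
  level_total phi x = level_total phi y.
Proof.
have adjE a b : adj G a b ->
    level_total phi a = level_lim phi a b + level_lim phi b a.
  move=> ab; rewrite /level_total (bigD1_seq b) ?fset_uniq //=; congr (_ + _).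
  by rewrite [RHS]level_lim_split // adj_sym.
have [n [p [+ + _]]] := Gconn x y.
elim: p x {n} => [x _ /= -> //|z p IH x /= /andP[xz pz] /(IH _ pz) <-].
have zx : adj G z x by rewrite adj_sym.
by rewrite (adjE _ _ xz) (adjE _ _ zx) addrC.
Qed.

Lemma level_total_distribution o : distributions G K (level_total^~ o).
Proof.
move=> v phi psi; rewrite /level_total /= mulr_sumr -big_split big_seq.
by rewrite [RHS]big_seq; apply: eq_bigr => b ob; exact: level_lim_linear.
Qed.

(** With the base moved to [a], only the cylinder towards [b] contributes. *)
Lemma level_total_ind o a b : adj G a b -> level_total (ind a b) o = m a b.
Proof.
move=> ab; rewrite (level_total_base _ o a) /level_total.
rewrite (bigD1_seq b) ?fset_uniq //= big_seq_cond big1 ?addr0.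
  rewrite -[RHS]mul1r; apply: level_limE; apply: filterE => n.
  by apply: level_cst => // w wab; rewrite indE // [ray_to _ _ _]wab eqxx.
move=> c /andP[ac cb]; rewrite -[RHS](mul0r (m a c)); apply: level_limE.
apply: filterE => n; apply: level_cst => // w wac.
by rewrite indE // [ray_to _ _ _]wac (negbTE cb).
Qed.

End Extension.

Hypothesis nde : no_dead_ends G.

Lemma cyl_nonempty a b : adj G a b -> exists w, cyl a b w.
Proof.
move=> ab.
have [e [<- <-]] := edgeP ab; have [s [rs s0 s1]] := nde e.
have [w ws] := ray_boundary Gac rs; exists w.
by rewrite /cyl /= (ray_to_unique Gconn Gac ws s0).
Qed.

Lemma distribution_of_additive (o : V) (m : V -> V -> K) :
  (forall a b, adj G a b -> m a b = \sum_(c <- nbr G b | c != a) m b c) ->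
  exists2 mu, distributions G K mu &
    forall a b, adj G a b -> mu (ind a b) = m a b.
Proof.
move=> madd.
(* If [o] has no neighbour, connectedness leaves no edge at all, and the zero functional serves. *)
have [[b ob]|nob] := pselect (exists b, adj G o b); last first.
  exists (fun=> 0) => [v phi psi /=|a b ab]; first by rewrite mulr0 addr0.
  exfalso; apply: nob; have [n [[|c p] []]] := Gconn o a.
    by move=> _ /= -> _; exists b.
  by case/andP=> oc _ _ _; exists c.
have [w0 _] := cyl_nonempty ob.
pose pt a b := xget w0 (cyl a b).
have ptP a c : adj G a c -> cyl a c (pt a c).
  by move=> /cyl_nonempty[w wac]; exact: xgetI wac.
exists (level_total m pt ^~ o); first exact: level_total_distribution.
by move=> a c ac; exact: level_total_ind.
Qed.

End CylinderDecomposition.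

(** * Covers and deck transformations *)

Section Covers.
Context {V X : choiceType} (Gt : graph V) (G : graph X) (p : V -> X).
Hypothesis cov : universal_cover Gt G p.
Implicit Types (x y u : V).

Lemma cover_connected : connected_graph Gt. Proof. by case: cov. Qed.

Lemma cover_acyclic : acyclic Gt. Proof. by case: cov. Qed.

Lemma cover_surj a : exists x, p x = a. Proof. by case: cov. Qed.

Lemma cover_adj x y : adj Gt x y -> adj G (p x) (p y).
Proof.
case: cov => _ _ _ /(_ x)[_ e] xy.
by rewrite /adj -e; apply/imfsetP; exists y.
Qed.

Lemma cover_lift x a : adj G (p x) a -> exists2 y, adj Gt x y & p y = a.
Proof.
case: cov => _ _ _ /(_ x)[_ e]; rewrite /adj -e => /imfsetP[y /= xy ->].
by exists y.
Qed.

Lemma cover_inj x : {in nbr Gt x &, injective p}.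
Proof. by case: cov => _ _ _ /(_ x)[]. Qed.

Lemma cover_sum (R : nmodType) x (P : pred X) (F : X -> R) :
  \sum_(y <- nbr Gt x | P (p y)) F (p y) = \sum_(a <- nbr G (p x) | P a) F a.
Proof.
case: cov => _ _ _ /(_ x)[inj <-].
by rewrite [in RHS]big_mkcond big_imfset //= -big_mkcond.
Qed.

Lemma cover_no_dead_ends : no_dead_ends G -> no_dead_ends Gt.
Proof.
move=> nde [[a b] ab].
have [|s [rs s0 s1 _]] := @ray_of_steps _ Gt (fun _ _ => True) _ a b ab I.
  move=> {}a {}b {}ab _.
  have [e [se te]] := edgeP (cover_adj ab); have [s [rs s0 s1]] := nde e.
  have [_ s20] := rs 0%N; have [s2 _] := rs 1%N.
  rewrite s0 se in s20; rewrite s1 te in s2.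
  have [c bc pc] := cover_lift s2; exists c; split=> //.
  by apply: contraNneq s20 => ca; rewrite -pc ca.
by exists s.
Qed.

Definition cover_map (h : V -> V) :=
  (forall x y, adj Gt x y -> adj Gt (h x) (h y)) /\ p \o h = p.

(** Agreement propagates along walks, since [p] is injective on the neighbours of a vertex. *)
Lemma cover_map_unique h1 h2 x : cover_map h1 -> cover_map h2 ->
  h1 x = h2 x -> h1 = h2.
Proof.
move=> [a1 p1] [a2 p2] e; apply/funext => y.
have [n [l [+ + _]]] := cover_connected x y.
elim: l x e {n} => [x e _ /= <- //|z l IH x e /= /andP[xz lz] ly].
apply: (IH z) => //; apply: (@cover_inj (h1 x)).
- exact: a1.
- by rewrite e; exact: a2.
have e1 := congr1 (@^~ z) p1; have e2 := congr1 (@^~ z) p2.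
by move: e1 e2 => /= -> ->.
Qed.

Section Lifting.
Context (x x' : V) (pxx' : p x = p x').

(** Endpoint of the lift, started at [x'], of the projected walk that runs from the last vertex of
    [y :: l] back to [y]. *)
Fixpoint path_lift y l : V :=
  if l is y1 :: l' then
    let u := path_lift y1 l' in xget u [set v | adj Gt u v /\ p v = p y]
  else x'.

Lemma path_lift_cons y y1 l : p (path_lift y1 l) = p y1 -> adj Gt y1 y ->
  adj Gt (path_lift y1 l) (path_lift y (y1 :: l)) /\
  p (path_lift y (y1 :: l)) = p y.
Proof.
move=> e y1y /=; have [|v lv pv] := @cover_lift (path_lift y1 l) (p y).
  by rewrite e; exact: cover_adj.
pose A := [set v | adj Gt (path_lift y1 l) v /\ p v = p y].
exact: (xgetI _ (conj lv pv : A v)).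
Qed.

Lemma p_path_lift y l : path (adj Gt) y l -> last y l = x ->
  p (path_lift y l) = p y.
Proof.
elim: l y => [y _ /= ->|y1 l IH y /= /andP[yy1 pl] e] //.
by have [] := @path_lift_cons y y1 l (IH _ pl e) _; rewrite // adj_sym.
Qed.

Definition translate y : V := path_lift y (geod Gt x y).

Lemma p_translate y : p (translate y) = p y.
Proof.
have [r e] := geodP cover_connected x y.
exact: p_path_lift (reduced_path r) e.
Qed.

Lemma translate_base : translate x = x'.
Proof. by rewrite /translate (geodxx cover_connected cover_acyclic). Qed.

(** For adjacent vertices one geodesic from [x] extends the other by an edge, so the two values
    differ by one lifting step. *)
Lemma translate_cover_map : cover_map translate.
Proof.
split=> [y y' yy'|]; last by apply/funext => y; exact: p_translate.
have [e|e] := geod_adj cover_connected cover_acyclic x yy'.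
  rewrite {2}/translate e.
  by have [] := @path_lift_cons y' y (geod Gt x y) (p_translate y) yy'.
rewrite adj_sym {2}/translate e; rewrite adj_sym in yy'.
by have [] := @path_lift_cons y y' (geod Gt x y') (p_translate y') yy'.
Qed.

End Lifting.

(** The lifts taking [x] to [x'] and [x'] to [x] are mutually inverse: their composites fix a
    vertex, so [cover_map_unique] makes them the identity. *)
Lemma deck_transitive x x' : p x = p x' ->
  exists g : automorphism Gt, deck p g /\ g x = x'.
Proof.
move=> e; have [g1 pg] := translate_cover_map e.
have [h1 ph] := translate_cover_map (esym e).
set g := translate x x' in g1 pg; set h := translate x' x in h1 ph.
have gx : g x = x' by exact: translate_base.
have hx : h x' = x by exact: translate_base.
have idm : cover_map idfun by [].
have hg : h \o g = idfun.
  apply: (@cover_map_unique _ _ x) => //=; last by rewrite gx.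
  split=> [y z yz|]; first exact/h1/g1.
  by rewrite compA ph.
have gh : g \o h = idfun.
  apply: (@cover_map_unique _ _ x') => //=; last by rewrite hx.
  split=> [y z yz|]; first exact/g1/h1.
  by rewrite compA pg.
have gK : cancel g h by move=> y; exact: (congr1 (@^~ y) hg).
have hK : cancel h g by move=> y; exact: (congr1 (@^~ y) gh).
have gnbr y z : (g z \in nbr Gt (g y)) = (z \in nbr Gt y).
  by apply/idP/idP => [/h1|/g1//]; rewrite !gK.
by exists (Automorphism (Bijective gK hK) gnbr).
Qed.

End Covers.

(** * Automorphisms of a tree and their action on the boundary *)

Section Automorphisms.
Context {V : choiceType} (G : graph V).
Hypotheses (Gconn : connected_graph G) (Gac : acyclic G).
Implicit Types (g : automorphism G) (x y a b o : V) (w : boundary G).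

Lemma aut_inj g : injective g. Proof. exact/bij_inj/aut_bij. Qed.

Lemma aut_adj g a b : adj G (g a) (g b) = adj G a b.
Proof. exact: aut_nbr. Qed.

Lemma parity_aut g o x : parity G o (g x) = parity G o (g o) (+) parity G o x.
Proof.
have oo : parity G o o = false by rewrite /parity geodxx.
have [n [l [pl le sl]]] := Gconn o x.
have w1 : walk G o x n by exists l.
have w2 : walk G (g o) (g x) n.
  exists (map g l); rewrite last_map le size_map sl; split=> //.
  by rewrite path_map; apply: sub_path pl => y z /=; rewrite aut_adj.
have := parity_walk Gconn Gac o w2; rewrite (parity_walk Gconn Gac o w1) oo.
by rewrite addFb => ->; rewrite addbA addbb.
Qed.

Lemma ray_to_aut g x w : ray_to (g x) (aut_boundary g w) = g \o ray_to x w.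
Proof.
have [wr r0] := ray_toP Gconn Gac x w.
apply: ray_to_unique => //=; last by rewrite r0.
by exists (ray_to x w).
Qed.

Lemma cyl_aut g a b w : cyl (g a) (g b) (aut_boundary g w) <-> cyl a b w.
Proof.
rewrite /cyl /= ray_to_aut /=.
by split=> [/aut_inj|->].
Qed.

(** Converse of [locally_constant_ray]. A criterion in terms of rays and cylinders is visibly
    preserved by automorphisms, which gives [locally_constant_aut]. *)
Lemma ray_locally_constant (U : Type) (phi : boundary G -> U) :
  (forall s, ray G s ->
    exists n v, forall w, cyl (s n) (s n.+1) w -> phi w = v) ->
  locally_constant phi.
Proof.
move=> phiP w; have [s ws] : exists s, val w s.
  by have := valP w; rewrite inE => -[s rs _]; exists (ray_to (s 0%N) w);
     exact: (ray_toP Gconn Gac (s 0%N) w).1.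
have rs := boundary_ray ws; have [n [v phiv]] := phiP s rs.
have snw : cyl (s n) (s n.+1) w.
  have es := ray_to_unique Gconn Gac ws erefl.
  have := ray_to_shift Gconn Gac (s 0%N) w n; rewrite es /cyl /= => ->.
  by rewrite /shift addn1.
have : nbhs w (cyl (s n) (s n.+1)).
  apply: open_nbhs_nbhs; split=> //; apply: cyl_open.
  exact: (rs n).1.
by apply: filterS => w' /phiv ->; rewrite (phiv w).
Qed.

Lemma locally_constant_aut (U : Type) (phi : boundary G -> U) g :
  locally_constant phi -> locally_constant (phi \o aut_boundary g).
Proof.
move=> lphi; apply: ray_locally_constant => s rs.
have rgs : ray G (g \o s) by exact/aut_rayE.
have [n [v phiv]] := locally_constant_ray Gconn Gac lphi rgs.
by exists n, v => w wn; apply/phiv/cyl_aut.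
Qed.

End Automorphisms.

(** * Poisson transform and group action at the parameter -1 *)

Section SignRepresentation.
Context {V : choiceType} (G : graph V) (K : fieldType) (o : V).
Hypotheses (Gconn : connected_graph G) (Gac : acyclic G).
Implicit Types (g : automorphism G) (x y a b : V) (w : boundary G).
Implicit Types (phi : lcfun G K) (mu : lcfun G K -> K^o).

Definition sgn x : K := (-1) ^+ parity G o x.

Lemma sgn_base : sgn o = 1.
Proof. by rewrite /sgn /parity geodxx. Qed.

Lemma sgn_sqr x : sgn x * sgn x = 1.
Proof. by rewrite /sgn -signr_addb addbb. Qed.

Lemma sgn_adj x y : adj G x y -> sgn y = - sgn x.
Proof. by move=> xy; rewrite /sgn (parity_adj Gconn Gac o xy) signrN. Qed.

Lemma sgn_aut g x : sgn (g x) = sgn (g o) * sgn x.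
Proof. by rewrite /sgn (parity_aut Gconn Gac) signr_addb. Qed.

Lemma signz_sub m n : (-1) ^ (m%:Z - n%:Z) = (-1) ^+ (odd m (+) odd n) :> K.
Proof.
rewrite expfzDr ?oppr_eq0 ?oner_eq0 // -invr_expz -!exprnP invr_sign.
by rewrite signr_addb !signr_odd.
Qed.

(* The parities of the distances in [horo] do not depend on the confluence
   point, since a tree is 2-colourable. *)
Lemma sign_horo x w : (-1) ^ horo o x w = sgn x.
Proof.
rewrite /horo signz_sub !(parity_dist Gconn Gac o) /sgn.
have -> : parity G o o = false by rewrite /parity geodxx.
by rewrite addFb addbCA addbb addbF.
Qed.

Lemma poissonE mu x : distributions G K mu ->
  poisson o (-1) mu x = sgn x * mu (one_lc G K).
Proof.
move=> dmu; rewrite -distributionZ //; congr (mu _).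
apply: lcfun_eq => w; rewrite /one_lc.
have -> : (fun w => (-1) ^ horo o x w : K^o) = (fun _ : boundary G => sgn x).
  by apply/funext => w'; exact: sign_horo.
rewrite -[insubd _ _]/(lcf _) lcfE; last exact: locally_constant_cst.
have -> : val (sgn x *: lcf (fun=> 1)) w = sgn x * val (lcf (fun=> 1)) w by [].
by rewrite lcfE ?mulr1 //; exact: locally_constant_cst.
Qed.

Definition comp_lc g phi : lcfun G K := lcf (val phi \o aut_boundary g).

Lemma comp_lcE g phi w : val (comp_lc g phi) w = val phi (aut_boundary g w).
Proof. by rewrite lcfE //; apply/locally_constant_aut/locally_constant_val. Qed.

Lemma comp_lc_ind g a b : adj G a b ->
  comp_lc g (ind G K (g a) (g b)) = ind G K a b.
Proof.
move=> ab; apply: lcfun_eq => w; rewrite comp_lcE !indE ?aut_adj //.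
by rewrite ray_to_aut //= (inj_eq (@aut_inj _ _ _)).
Qed.

(** By [sign_horo] the multiplier is the constant [sgn (g o)], so the action is the push-forward up
    to a sign. *)
Lemma pi_repE g mu phi : distributions G K mu ->
  pi_rep o (-1) g mu phi = sgn (g o) * mu (comp_lc g phi).
Proof.
move=> dmu; rewrite -distributionZ //; congr (mu _).
rewrite -[RHS]lcf_val -[insubd _ _]/(lcf _); congr lcf; apply/funext => w.
rewrite -invr_expz sign_horo /sgn invr_sign -[insubd _ _]/(comp_lc g phi) //.
Qed.

Lemma pi_rep_distribution g mu : distributions G K mu ->
  distributions G K (pi_rep o (-1) g mu).
Proof.
move=> dmu v phi psi; rewrite !pi_repE // mulrCA -mulrDr /=; congr (_ * _).
rewrite -(distributionZ dmu) -(distributionD dmu); congr (mu _).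
by apply: lcfun_eq => w; rewrite comp_lcE /= !fctE /= -!comp_lcE.
Qed.

(** It suffices to test on cylinders; [sgn_aut] then turns the fixed-point equation into invariance
    of the signed cylinder masses. *)
Lemma pi_rep_fixedP (g : automorphism G) mu : distributions G K mu ->
  pi_rep o (-1) g mu = mu <->
  forall a b, adj G a b ->
    sgn (g a) * mu (ind G K (g a) (g b)) = sgn a * mu (ind G K a b).
Proof.
move=> dmu; split=> [e a b ab|e].
  rewrite -[in LHS]e pi_repE // comp_lc_ind // sgn_aut [sgn (g o) * _]mulrC.
  by rewrite mulrA -[_ * _ * sgn (g o)]mulrA sgn_sqr mulr1.
apply: (distributions_eq Gconn Gac o (pi_rep_distribution g dmu) dmu) => a b.
have [h hK gK] := aut_bij g; rewrite -(gK a) -(gK b) aut_adj => ab.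
rewrite pi_repE // comp_lc_ind //.
have := e _ _ ab => /(congr1 (fun v => sgn (g (h a)) * v)).
rewrite !mulrA sgn_sqr mul1r => ->; rewrite (sgn_aut g (h a)) -!mulrA.
by congr (_ * _); rewrite mulrA sgn_sqr mul1r.
Qed.

End SignRepresentation.

(** * Dimensions and edge functions *)

Section DimensionLemmas.
Context (K : fieldType).

Lemma has_dim0 (V : lmodType K) : has_dim K [set 0 : V] 0.
Proof.
exists (fun=> 0); split=> [c _ [] //|]; apply/seteqP; split=> v /=.
  by move=> ->; exists (fun=> 0); rewrite big_ord0.
by move=> [c ->]; rewrite big_ord0.
Qed.

Lemma has_dim_extend (V : lmodType K) (A B : set V) (w : V) n : has_dim K A n ->
  ~ A w -> (forall v, B v <-> exists k a, A a /\ v = k *: w + a) ->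
  has_dim K B n.+1.
Proof.
move=> [e [efree Ae]] Aw Bw.
exists (fun i => oapp e w (unlift ord0 i)).
have sumE (c : 'I_n.+1 -> K) :
    \sum_(i < n.+1) c i *: oapp e w (unlift ord0 i) =
    c ord0 *: w + \sum_(i < n) c (lift ord0 i) *: e i.
  rewrite big_ord_recl unlift_none; congr (_ + _).
  by apply: eq_bigr => i _; rewrite liftK.
split=> [c|].
  rewrite sumE => c0; have c00 : c ord0 = 0.
    apply: contra_notP Aw => /eqP c00; rewrite Ae.
    exists (fun i => - (c ord0)^-1 * c (lift ord0 i)).
    under eq_bigr do rewrite -scalerA.
    rewrite -scaler_sumr; apply: (scalerI c00).
    rewrite scalerA mulrN divff // scaleN1r; apply/eqP.
    by rewrite -addr_eq0 c0.
  move: c0; rewrite c00 scale0r add0r => /efree c0 i.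
  by case: (unliftP ord0 i) => [j|] ->; rewrite ?c0.
apply/seteqP; split=> v.
  move=> /Bw[k [a [+ ->]]]; rewrite Ae => -[c ->].
  exists (fun i => oapp c k (unlift ord0 i)); rewrite sumE unlift_none.
  by congr (_ + _); apply: eq_bigr => i _; rewrite liftK.
move=> [c ->]; apply/Bw; rewrite sumE.
exists (c ord0), (\sum_(i < n) c (lift ord0 i) *: e i); split=> //.
by rewrite Ae; exists (fun i => c (lift ord0 i)).
Qed.

Lemma has_dim_line (V : lmodType K) (v : V) : v != 0 ->
  has_dim K [set k *: v | k in [set: K]] 1.
Proof.
move=> v0; apply: (has_dim_extend (has_dim0 V) (w := v)); first exact/eqP.
move=> u; split=> [[k _ <-]|[k [_ [-> ->]]]]; last by exists k; rewrite ?addr0.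
by exists k, 0; rewrite addr0.
Qed.

(** Subspaces are plain sets here, so linear closure and injectivity on [A] are hypotheses;
    preimages of a basis of [B] form a basis of [A]. *)
Lemma has_dim_transfer (V W : lmodType K) (T : V -> W)
    (A : set V) (B : set W) n :
  linear T -> (forall k u v, A u -> A v -> A (k *: u + v)) -> A 0 ->
  (forall v, A v -> T v = 0 -> v = 0) -> T @` A = B ->
  has_dim K B n -> has_dim K A n.
Proof.
move=> linT lcA A0 injT <- [e [efree eB]].
pose T' : {linear V -> W} := HB.pack T (GRing.isLinear.Build _ _ _ _ T linT).
have ex i : exists v, A v /\ T v = e i.
  have : (T @` A) (e i).
    rewrite eB; exists (fun j => (j == i)%:R).
    rewrite (bigD1 i) //= eqxx scale1r big1 ?addr0 // => j /negbTE ->.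
    by rewrite scale0r.
  by move=> [v Av <-]; exists v.
have [a aP] := choice ex.
have Asum (c : 'I_n -> K) : A (\sum_(i < n) c i *: a i).
  elim/big_ind: _ => // [u v Au Av|i _]; first by rewrite -[u]scale1r; exact: lcA.
  by rewrite -[_ *: _]addr0; apply: lcA => //; exact: (aP i).1.
have Tsum (c : 'I_n -> K) : T (\sum_(i < n) c i *: a i) = \sum_(i < n) c i *: e i.
  rewrite -[T _]/(T' _) linear_sum; apply: eq_bigr => i _.
  by rewrite linearZ /= (aP i).2.
exists a; split=> [c c0|].
  by apply: efree; rewrite -Tsum c0; exact: (linear0 T').
apply/seteqP; split=> [v Av|_ [c ->]]; last exact: Asum.
have : (T @` A) (T v) by exists v.
rewrite eB => -[c cE]; exists c; apply/eqP; rewrite -subr_eq0; apply/eqP.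
apply: injT; last by rewrite -[T _]/(T' _) linearB /= Tsum cE subrr.
by rewrite -scaleN1r addrC; apply: lcA.
Qed.

Lemma has_dim_row_space m n (M : 'M[K]_(m, n)) :
  has_dim K [set u : 'rV[K]_n | (u <= M)%MS] (\rank M).
Proof.
exists (fun i => row i (row_base M)).
have sumE (c : 'I_(\rank M) -> K) :
    \sum_(i < \rank M) c i *: row i (row_base M) = (\row_i c i) *m row_base M.
  by rewrite mulmx_sum_row; apply: eq_bigr => i _; rewrite mxE.
split=> [c|].
  rewrite sumE -[RHS](mul0mx _ (row_base M)) => /(row_free_inj (row_base_free M)).
  by move=> /matrixP e i; have := e 0 i; rewrite !mxE.
apply/seteqP; split=> u /=.
  rewrite -(eq_row_base M) => /submxP[D ->]; exists (fun i => D 0 i).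
  by rewrite sumE; congr (_ *m _); apply/rowP => i; rewrite mxE.
by move=> [c ->]; rewrite sumE -(eq_row_base M) submxMl.
Qed.

End DimensionLemmas.

(** * The eigenvalue equation of the edge Laplacian *)

Section EdgeFunctions.
Context {V : choiceType} (G : graph V) (K : fieldType).
Implicit Types (f : dedge G -> K^o) (a b c : V).

(** Extension by 0 to all pairs, so that sums can run over neighbours instead of dependent pairs. *)
Definition edge_val f a b : K :=
  oapp f 0 (insub (a, b) : option {e : V * V | e.2 \in nbr G e.1}).

Lemma edge_valE f e : edge_val f (src e) (tgt e) = f e.
Proof.
rewrite /edge_val /src /tgt; case: e => -[a b] ab /=.
by rewrite insubT /=; congr f; apply: val_inj.
Qed.

Lemma edge_val_linear k f f' a b :
  edge_val (k *: f + f') a b = k * edge_val f a b + edge_val f' a b.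
Proof.
by rewrite /edge_val; case: insub => [e|] /=; rewrite ?fctE ?mulr0 ?addr0.
Qed.

Definition vertex_sum f a : K := \sum_(b <- nbr G a) edge_val f a b.

Lemma vertex_sum_linear k f f' a :
  vertex_sum (k *: f + f') a = k * vertex_sum f a + vertex_sum f' a.
Proof.
rewrite /vertex_sum mulr_sumr -big_split.
by apply: eq_bigr => b _; exact: edge_val_linear.
Qed.

Lemma edge_laplacianE f (e : dedge G) : edge_laplacian f e =
  \sum_(c <- nbr G (tgt e) | c != src e) edge_val f (tgt e) c.
Proof.
rewrite /edge_laplacian -[RHS]big_filter [RHS]fsbig_seq; last first.
  exact/filter_uniq/fset_uniq.
rewrite [RHS](@reindex_fsbig _ _ _ _ _ (fun e' : dedge G => tgt e')
  [set e' : dedge G | src e' = tgt e /\ val e' <> (tgt e, src e)]); last first.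
  split=> [e' /= [se ve]|e1 e2|c /=].
  - rewrite mem_filter -se (src_tgt e' : tgt e' \in nbr G (src e')) andbT.
    apply: contra_not_neq ve => te; rewrite -se -te.
    by case: e' {se te} => -[].
  - rewrite !inE => -[s1 _] [s2 _] t12; apply: val_inj.
    case: e1 e2 s1 s2 t12 => [[a b] ?] [[a' b'] ?].
    by rewrite /src /tgt /= => -> <- ->.
  rewrite mem_filter => /andP[ce /edgeP[e' [se te]]].
  exists e' => //; split=> //.
  by move=> /(congr1 snd) ve; move: ce; rewrite -te [tgt e']ve eqxx.
by apply: eq_fsbigr => e'; rewrite inE => -[<- _]; rewrite edge_valE.
Qed.

Lemma eigen_edgeP z f : eigen_edge G z f <-> forall a b, adj G a b ->
  \sum_(c <- nbr G b | c != a) edge_val f b c = z * edge_val f a b.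
Proof.
split=> [ef a b /edgeP[e [<- <-]]|ef].
  by rewrite -edge_laplacianE ef edge_valE.
rewrite /eigen_edge /=; apply/funext => e.
by rewrite edge_laplacianE ef ?edge_valE //; exact: src_tgt.
Qed.

(** Adding the excluded backtracking term completes the Laplacian to the full vertex sum. *)
Lemma eigen_edgeN1P f : eigen_edge G (-1) f <->
  forall a b, adj G a b -> edge_val f b a - edge_val f a b = vertex_sum f b.
Proof.
have sumE a b : adj G a b ->
    vertex_sum f b = edge_val f b a + \sum_(c <- nbr G b | c != a) edge_val f b c.
  move=> ab; rewrite /vertex_sum (bigD1_seq a) ?fset_uniq //.
  by rewrite -/(adj G b a) adj_sym.
rewrite eigen_edgeP; split=> ef a b ab.
  by rewrite (sumE a b ab) ef // mulN1r.
by apply: (addrI (edge_val f b a)); rewrite -sumE // mulN1r ef.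
Qed.

Lemma vertex_sum_adj f a b : eigen_edge G (-1) f -> adj G a b ->
  vertex_sum f b = - vertex_sum f a.
Proof.
move=> /eigen_edgeN1P ef ab; rewrite -(ef _ _ ab).
by rewrite adj_sym in ab; rewrite -(ef _ _ ab) opprB.
Qed.

Lemma eigen_edge_linear z k f f' : eigen_edge G z f -> eigen_edge G z f' ->
  eigen_edge G z (k *: f + f').
Proof.
move=> /eigen_edgeP ef /eigen_edgeP ef'; apply/eigen_edgeP => a b ab.
rewrite edge_val_linear mulrDr mulrCA -ef // -ef' // mulr_sumr -big_split.
by apply: eq_bigr => c _; exact: edge_val_linear.
Qed.

End EdgeFunctions.

(** * Edge eigenfunctions on finite graphs *)

Section FiniteGraphs.
Context {X : finType} (G : graph X) (K : fieldType).
Hypotheses (Gconn : connected_graph G) (charK : [pchar K] =i pred0).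
Implicit Types (f : dedge G -> K^o) (x y a b c : X) (h : X -> K).

Let U := undirected_edges G.
Let m := #|U|.
Let n := #|X|.

Lemma natr_char0_inj : injective (fun k : nat => k%:R : K).
Proof.
have nat0 k : (k%:R == 0 :> K) = (k == 0)%N by exact: (pcharf0P K).1.
move=> j k; wlog jk : j k / (j <= k)%N => [W e|/= /esym/eqP].
  by case: (leqP j k) => [/W|/ltnW/W]; [apply|move/(_ (esym e))].
rewrite -subr_eq0 -natrB // nat0 subn_eq0 => kj.
by apply/eqP; rewrite eqn_leq jk.
Qed.

Lemma eq_opp0 (v : K) : v = - v -> v = 0.
Proof.
move=> /eqP; rewrite -addr_eq0 -mulr2n -mulr_natr mulf_eq0.
by have /pcharf0P -> := charK; rewrite orbF => /eqP.
Qed.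

Section Alternating.
Context (h : X -> K) (h_alt : forall a b, adj G a b -> h b = - h a).

Lemma alternating_sqr x y : h x = h y \/ h x = - h y.
Proof.
have [k [l [+ + _]]] := Gconn x y.
elim: l x {k} => [x _ /= ->|z l IH x /= /andP[xz /IH{}IH /IH]]; first by left.
rewrite (h_alt xz) => -[e|e]; [right|left]; first by rewrite -e opprK.
by apply: oppr_inj.
Qed.

(** An alternating function takes only two opposite values; if nonzero they are distinct in
    characteristic 0 and define a 2-colouring. *)
Lemma alternating0 : ~~ two_colorable G -> forall x, h x = 0.
Proof.
move=> ntc x; apply: contraNeq ntc => hx.
apply/existsP; exists [ffun y => h y == h x]; apply/forallP => a.
apply/forallP => b; apply/implyP => ab; rewrite !ffunE (h_alt ab).
have hx2 : (- h x == h x) = false.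
  by apply: contraNF hx => /eqP/esym/eq_opp0 ->.
by case: (alternating_sqr a x) => ->; rewrite ?opprK hx2 eqxx.
Qed.

End Alternating.

Lemma sum_nbr (R : nmodType) x (F : X -> R) :
  \sum_(b <- nbr G x) F b = \sum_(b | adj G x b) F b.
Proof. by rewrite big_uniq // fset_uniq. Qed.

Lemma set2_inj x y z : [set x; y]%SET = [set x; z]%SET -> y = z.
Proof.
move=> e; have := congr1 (fun A : {set X} => y \in A) e.
have := congr1 (fun A : {set X} => z \in A) e; rewrite !inE !eqxx !orbT.
case: (eqVneq y z) => //= _; rewrite !orbF => /eqP zx /esym/eqP yx.
by rewrite zx yx.
Qed.

Lemma undirected_edgesP (A : {set X}) :
  reflect (exists a b, adj G a b /\ A = [set a; b]%SET) (A \in U).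
Proof.
apply: (iffP imsetP) => [[[a b] ab ->]|[a [b [ab ->]]]].
  by rewrite inE in ab; exists a, b.
by exists (a, b); rewrite ?inE.
Qed.

Lemma sum_incident (R : nmodType) x (psi : {set X} -> R) :
  \sum_(A in U | x \in A) psi A = \sum_(b <- nbr G x) psi [set x; b]%SET.
Proof.
rewrite sum_nbr -(big_imset psi (h := fun b => [set x; b]%SET)) /=; last first.
  by move=> y z _ _; exact: set2_inj.
apply: eq_bigl => A; apply/andP/imsetP => [[/undirected_edgesP[a [b [ab ->]]]]|].
  rewrite !inE => /orP[] /eqP ->; first by exists b.
  exists a; last by rewrite finset.setUC.
  by rewrite -[_ \in _]/(adj G b a) adj_sym.
move=> [b xb ->]; split; last by rewrite !inE eqxx.
by apply/undirected_edgesP; exists x, b.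
Qed.

Lemma card_undirected_edge A : A \in U -> #|A| = 2%N.
Proof.
move=> /undirected_edgesP[a [b [ab ->]]]; rewrite cards2.
by case: eqVneq ab => // ->; rewrite adj_irr.
Qed.

(** Handshake lemma, by exchanging the sums over vertices and edges. *)
Lemma sum_degree : \sum_x \sum_(b <- nbr G x) (1 : K) = m%:R *+ 2.
Proof.
under eq_bigr do rewrite -(sum_incident _ (fun=> 1)) big_mkcondr.
rewrite exchange_big /= -sumr_const -sumrMnl; apply: eq_bigr => A AU.
by rewrite -big_mkcond /= sumr_const card_undirected_edge.
Qed.

Definition incidence : 'M[K]_(m, n) :=
  \matrix_(i, j) (enum_val j \in (enum_val i : {set X}))%:R.

Lemma edge_in_edges (e : dedge G) : [set src e; tgt e]%SET \in U.
Proof. by apply/undirected_edgesP; exists (src e), (tgt e); rewrite src_tgt. Qed.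

Definition edge_index (e : dedge G) : 'I_m :=
  enum_rank_in (edge_in_edges e) [set src e; tgt e]%SET.

Lemma enum_val_edge_index e : enum_val (edge_index e) = [set src e; tgt e]%SET.
Proof. by rewrite enum_rankK_in //; exact: edge_in_edges. Qed.

Lemma edge_index_surj i : exists e, edge_index e = i.
Proof.
have /undirected_edgesP[a [b [ab e]]] := enum_valP i.
have [d [sd td]] := edgeP ab; exists d; apply: enum_val_inj.
by rewrite enum_val_edge_index sd td.
Qed.

Definition edge_fun (u : 'rV[K]_m) : dedge G -> K^o := fun e => u 0 (edge_index e).

Lemma edge_fun_sym u a b : edge_val (edge_fun u) a b = edge_val (edge_fun u) b a.
Proof.
have [ab|nab] := boolP (adj G a b).
  have [e [<- <-]] := edgeP ab.
  have [e' [se te]] := edgeP (etrans (adj_sym G (tgt e) (src e)) (src_tgt e)).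
  rewrite edge_valE -se -te edge_valE /edge_fun; congr (u _ _).
  by apply: enum_val_inj; rewrite !enum_val_edge_index se te finset.setUC.
have nba : ~~ adj G b a by rewrite adj_sym.
by rewrite /edge_val !insubN.
Qed.

Lemma vertex_sum_edge_fun u x :
  vertex_sum (edge_fun u) x = (u *m incidence) 0 (enum_rank x).
Proof.
(* The row vector viewed as a function on edges, which allows passing from indices to the sets
   themselves. *)
pose psi (A : {set X}) := \sum_i u 0 i * (enum_val i == A)%:R.
have psiE i : psi (enum_val i) = u 0 i.
  rewrite /psi (bigD1 i) //= eqxx mulr1 big1 ?addr0 // => j /negbTE ji.
  by rewrite (inj_eq enum_val_inj) ji mulr0.
rewrite mxE; under [RHS]eq_bigr do rewrite mxE enum_rankK -psiE.
rewrite -(big_enum_val (fun A => psi A * (x \in A)%:R)) /=.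
transitivity (\sum_(A in U | x \in A) psi A); last first.
  rewrite big_mkcondr; apply: eq_bigr => A _.
  by case: (x \in A); rewrite ?mulr1 ?mulr0.
rewrite sum_incident /vertex_sum !sum_nbr; apply: eq_bigr => b /edgeP[e [<- <-]].
by rewrite edge_valE -enum_val_edge_index psiE.
Qed.

Definition even_edge_functions : set (dedge G -> K^o) :=
  [set f | (forall a b, edge_val f a b = edge_val f b a) /\
           forall a, vertex_sum f a = 0].

(** The chosen directed edge with a given index has the same two endpoints, so it is the edge itself
    or its reverse. *)
Lemma even_edge_fun f : (forall a b, edge_val f a b = edge_val f b a) ->
  exists u, f = edge_fun u.
Proof.
move=> fE; have [r rK] := choice edge_index_surj.
exists (\row_i f (r i)); apply/funext => e; rewrite /edge_fun mxE.
have := congr1 enum_val (rK (edge_index e)).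
rewrite !enum_val_edge_index -!edge_valE; set e' := r _ => es.
have se : src e' \in [set src e; tgt e]%SET by rewrite -es !inE eqxx.
move: se es; rewrite !inE => /orP[] /eqP -> es; first by rewrite (set2_inj es).
have {}es : [set tgt e; tgt e']%SET = [set tgt e; src e]%SET.
  by rewrite es finset.setUC.
by rewrite (set2_inj es) fE.
Qed.

(** Reading off values at one chosen orientation of each edge identifies these functions with the
    left kernel of the incidence matrix. *)
Lemma has_dim_even_edge_functions :
  has_dim K even_edge_functions (\rank (kermx incidence)).
Proof.
have [r rK] := choice edge_index_surj.
apply: has_dim_transfer (has_dim_row_space (kermx incidence)).
- instantiate (1 := fun f => \row_i f (r i)).
  by move=> k f f'; apply/rowP => i; rewrite !mxE.
- move=> k f f' [fE fS] [f'E f'S]; split=> [a b|a].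
    by rewrite !edge_val_linear fE f'E.
  by rewrite vertex_sum_linear fS f'S mulr0 addr0.
- split=> [a b|a]; first by rewrite /edge_val; do 2 case: insub => //.
  rewrite /vertex_sum big1 // => b _; rewrite /edge_val.
  by case: insub.
- move=> f [/even_edge_fun[u ->] _] /rowP u0; apply/funext => e.
  by have := u0 (edge_index e); rewrite !mxE /edge_fun rK.
have rowK u : \row_i edge_fun u (r i) = u.
  by apply/rowP => i; rewrite mxE /edge_fun rK.
apply/seteqP; split=> [_ [f [/even_edge_fun[u ->] fS] <-]|u /sub_kermxP u0] /=.
  rewrite rowK; apply/sub_kermxP/rowP => j; rewrite [RHS]mxE.
  by rewrite -(enum_valK j) -vertex_sum_edge_fun.
exists (edge_fun u); rewrite ?rowK //; split=> [a b|a].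
  exact: edge_fun_sym.
by rewrite vertex_sum_edge_fun u0 mxE.
Qed.

(** At an edge, [v *m incidence^T] is the sum of the values of [v] at the two endpoints. *)
Lemma kermx_incidence_tr (v : 'rV[K]_n) : (v <= kermx incidence^T)%MS <->
  forall a b, adj G a b -> v 0 (enum_rank b) = - v 0 (enum_rank a).
Proof.
have sumE a b i : adj G a b -> enum_val i = [set a; b]%SET ->
    (v *m incidence^T) 0 i = v 0 (enum_rank a) + v 0 (enum_rank b).
  move=> ab ei; rewrite mxE (reindex _ (onW_bij _ (@enum_rank_bij X))) /=.
  under eq_bigr do rewrite !mxE enum_rankK ei.
  have nab : b != a by apply: contraTneq ab => ->; rewrite adj_irr.
  rewrite (bigD1 a) //= (bigD1 b) //= !inE !eqxx orbT !mulr1 big1 ?addr0 //.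
  by move=> c /andP[/negbTE ca /negbTE cb]; rewrite !inE ca cb mulr0.
split=> [/sub_kermxP v0 a b ab|v_alt].
  have [e [se te]] := edgeP ab; apply/eqP; rewrite -addr_eq0 addrC.
  by rewrite -(sumE a b (edge_index e)) ?v0 ?mxE // enum_val_edge_index se te.
apply/sub_kermxP/rowP => i; rewrite [RHS]mxE.
have /undirected_edgesP[a [b [ab ei]]] := enum_valP i.
by rewrite (sumE a b) // (v_alt _ _ ab) subrr.
Qed.

Lemma rank_incidence_not_bipartite : ~~ two_colorable G -> \rank incidence = n.
Proof.
move=> ntc; rewrite -mxrank_tr; apply/eqP; rewrite -[_ == _]/(row_free _).
rewrite -kermx_eq0; apply/rowV0P => v /kermx_incidence_tr v_alt.
apply/rowP => j; rewrite mxE -(enum_valK j).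
exact: (@alternating0 (fun x => v 0 (enum_rank x))).
Qed.

Section Bipartite.
Context (col : X -> bool) (colP : forall a b, adj G a b -> col a != col b).

Definition colour_sign x : K := (-1) ^+ col x.

Lemma colour_sign_sqr x : colour_sign x * colour_sign x = 1.
Proof. by rewrite /colour_sign -signr_addb addbb. Qed.

Lemma colour_sign_adj a b : adj G a b -> colour_sign b = - colour_sign a.
Proof.
move=> /colP ab; rewrite -signrN /colour_sign; congr (_ ^+ (nat_of_bool _)).
by case: (col a) (col b) ab => -[].
Qed.

Lemma alternating_colour h o : (forall a b, adj G a b -> h b = - h a) ->
  forall x, h x = h o * colour_sign o * colour_sign x.
Proof.
move=> h_alt x; have [k [l [+ + _]]] := Gconn x o.
elim: l x {k} => [x _ /= ->|z l IH x /= /andP[xz /IH{}IH /IH]].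
  by rewrite -mulrA colour_sign_sqr mulr1.
by rewrite (h_alt _ _ xz) (colour_sign_adj xz) mulrN => /oppr_inj.
Qed.

Definition colour_row : 'rV[K]_n := \row_j colour_sign (enum_val j).

Lemma colour_sign_neq0 x : colour_sign x != 0.
Proof. by rewrite signr_eq0. Qed.

Lemma rank_colour_row (o : X) : \rank colour_row = 1%N.
Proof.
rewrite rank_rV; case: eqVneq => // /rowP/(_ (enum_rank o))/eqP.
by rewrite !mxE (negbTE (colour_sign_neq0 _)).
Qed.

(** By [alternating_colour] the kernel of the transpose is the line spanned by the 2-colouring. *)
Lemma rank_incidence_bipartite (o : X) : \rank incidence = n.-1.
Proof.
rewrite -mxrank_tr.
have := mxrank_ker incidence^T.
have -> : \rank (kermx incidence^T) = 1%N.
  rewrite -(rank_colour_row o); apply/eqP; rewrite eqn_leq !mxrankS //.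
    apply/kermx_incidence_tr => a b ab.
    by rewrite !mxE !enum_rankK; exact: colour_sign_adj.
  apply/rV_subP => v /kermx_incidence_tr v_alt.
  have -> : v = v 0 (enum_rank o) * colour_sign o *: colour_row.
    apply/rowP => j; rewrite !mxE -{1}(enum_valK j).
    exact: (@alternating_colour (fun x => v 0 (enum_rank x))).
  exact: scalemx_sub.
have := rank_leq_col incidence; rewrite -mxrank_tr -/n.
by move: (\rank _) => r rn /eqP e; apply/eqP; rewrite -eqSS prednK; [|lia]; lia.
Qed.

(** The row space lies in the orthogonal complement of the 2-colouring, and both have dimension one
    less than the number of vertices. *)
Lemma incidence_row_space (o : X) (v : 'rV[K]_n) :
  (v <= incidence)%MS = (\sum_x v 0 (enum_rank x) * colour_sign x == 0).
Proof.
have sumE (w : 'rV[K]_n) : (w *m colour_row^T) 0 0 =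
    \sum_x w 0 (enum_rank x) * colour_sign x.
  rewrite mxE (reindex _ (onW_bij _ (@enum_rank_bij X))) /=.
  by apply: eq_bigr => x _; rewrite !mxE enum_rankK.
have Bsub : (incidence <= kermx colour_row^T)%MS.
  apply/sub_kermxP/trmx_inj; rewrite trmx_mul trmxK trmx0; apply/sub_kermxP.
  apply/kermx_incidence_tr => a b ab.
  by rewrite !mxE !enum_rankK; exact: colour_sign_adj.
have /leqifP := mxrank_leqif_sup Bsub.
rewrite mxrank_ker mxrank_tr (rank_colour_row o) (rank_incidence_bipartite o).
rewrite -/n subn1 ltnn; case: ifP => // Bsup _.
have -> : (v <= incidence)%MS = (v <= kermx colour_row^T)%MS.
  by apply/idP/idP => /submx_trans; apply.
rewrite -sumE; apply/sub_kermxP/eqP => [->|v0]; first by rewrite mxE.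
by apply/rowP => j; rewrite [j]ord1 v0 mxE.
Qed.

End Bipartite.

Lemma even_edge_functionsE :
  even_edge_functions =
  [set f | eigen_edge G (-1) f /\ forall a, vertex_sum f a = 0].
Proof.
apply/seteqP; split=> f [fE fS]; split=> //.
  by apply/eigen_edgeN1P => a b _; rewrite fE subrr fS.
move=> a b; have [ab|nab] := boolP (adj G a b).
  apply/esym/eqP; rewrite -subr_eq0 -(fS b); apply/eqP.
  by move/eigen_edgeN1P: fE; apply.
have nba : ~~ adj G b a by rewrite adj_sym.
by rewrite /edge_val !insubN.
Qed.

Lemma two_colorableP :
  reflect (exists col : X -> bool, forall a b, adj G a b -> col a != col b)
    (two_colorable G).
Proof.
apply: (iffP existsP) => [[col colP]|[col colP]].
  by exists col => a b ab; move/forallP/(_ a)/forallP/(_ b)/implyP: colP; apply.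
exists (finfun col); apply/forallP => a; apply/forallP => b; apply/implyP => ab.
by rewrite !ffunE; exact: colP.
Qed.

Lemma has_dim_even_edge_functions_cyclomatic (o : X) :
  has_dim K even_edge_functions
    (if two_colorable G then cyclomatic G else (cyclomatic G).-1).
Proof.
have n0 : (0 < n)%N by apply/card_gt0P; exists o.
have := has_dim_even_edge_functions; rewrite mxrank_ker /cyclomatic -/m -/n.
case: (boolP (two_colorable G)) => [/two_colorableP[col colP]|ntc].
  rewrite (rank_incidence_bipartite colP o).
  by have -> : (m - n.-1 = m + 1 - n)%N by lia.
rewrite rank_incidence_not_bipartite //.
by have -> : (m - n = (m + 1 - n).-1)%N by lia.
Qed.

(* Summing the eigenvalue equation against the colouring counts each
   undirected edge twice and each vertex once. *)
Lemma vertex_sum_balance (col : X -> bool) (o : X) f :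
  (forall a b, adj G a b -> col a != col b) -> eigen_edge G (-1) f ->
  vertex_sum f o * n%:R = vertex_sum f o * m%:R.
Proof.
move=> colP fE; set s := vertex_sum f o * colour_sign col o.
have fS x : vertex_sum f x = s * colour_sign col x.
  by apply: (alternating_colour colP) => a b; exact: vertex_sum_adj.
pose T := \sum_x colour_sign col x * vertex_sum f x.
have T1 : T = s * n%:R.
  have -> : n%:R = \sum_(x : X) 1 :> K by rewrite sumr_const.
  rewrite mulr_sumr; apply: eq_bigr => x _.
  by rewrite fS mulrCA colour_sign_sqr.
have T2 : T = \sum_x \sum_(b | adj G x b) colour_sign col x * edge_val f x b.
  by apply: eq_bigr => x _; rewrite /vertex_sum sum_nbr mulr_sumr.
(* Reversing all edges exchanges their endpoints and flips the colour sign. *)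
have T3 : T = \sum_x \sum_(b | adj G x b) - (colour_sign col x * edge_val f b x).
  rewrite T2 (exchange_big_dep xpredT) //=; apply: eq_bigr => x _.
  apply: eq_big => [b|b]; first by rewrite adj_sym.
  by move=> /(colour_sign_adj colP) ->; rewrite mulNr opprK.
(* Adding the two expressions leaves, for each directed edge, a colour sign times the vertex sum at
   the same vertex, that is [s]. *)
have T4 : T *+ 2 = s * m%:R *+ 2.
  rewrite mulr2n {1}T2 T3 -big_split -mulrnAr -sum_degree mulr_sumr.
  apply: eq_bigr => x _; rewrite sum_nbr mulr_sumr -big_split.
  apply: eq_bigr => b xb; rewrite /= -mulrBr.
  have bx : adj G b x by rewrite adj_sym.
  rewrite ((eigen_edgeN1P f).1 fE _ _ bx) fS mulrCA colour_sign_sqr.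
  by rewrite mulr1.
have : s * n%:R = s * m%:R.
  have two : (2%:R : K) != 0 by have /pcharf0P -> := charK.
  by rewrite -T1; apply: (mulIf two); rewrite [LHS]mulr_natr T4 [RHS]mulr_natr.
rewrite /s ![_ * colour_sign _ _ * _]mulrAC.
by move/(mulIf (colour_sign_neq0 _ _)).
Qed.


(** In the bipartite case a nonzero vertex sum forces [n = m] by [vertex_sum_balance], hence
    cyclomatic number 1; otherwise alternation suffices. *)
Lemma vertex_sum_eq0 f :
  cyclomatic G <> 1%N \/ ~~ two_colorable G -> eigen_edge G (-1) f ->
  forall x, vertex_sum f x = 0.
Proof.
move=> h fE x; have f_alt a b : adj G a b -> vertex_sum f b = - vertex_sum f a.
  exact: vertex_sum_adj.
have [/two_colorableP[col colP]|ntc] := boolP (two_colorable G); last first.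
  exact: alternating0.
case: h => [c1|/two_colorableP[]]; last by exists col.
apply: contra_notP c1 => /eqP fx.
have := vertex_sum_balance x colP fE => /(mulfI fx)/natr_char0_inj nm.
by rewrite /cyclomatic -/m -/n nm; lia.
Qed.

(* The eigenfunction is [s (src e) / 2], with [s] the 2-colouring, plus an even
   function with prescribed vertex sums; by the description of the row space,
   the latter exists because |X| = |U|. *)
Lemma eigen_edge_vertex_sum (o : X) : cyclomatic G = 1%N -> two_colorable G ->
  exists2 f : dedge G -> K^o, eigen_edge G (-1) f & vertex_sum f o != 0.
Proof.
move=> c1 /two_colorableP[col colP].
have n0 : (0 < n)%N by apply/card_gt0P; exists o.
have nm : n = m by move: c1; rewrite /cyclomatic -/m -/n; lia.
have two : (2%:R : K) != 0 by have /pcharf0P -> := charK.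
pose s := colour_sign col; pose deg x : K := \sum_(b <- nbr G x) 1.
(* The summand [s (src e) / 2] contributes half the degree times [s]; [v] is what is missing to make
   all vertex sums equal to [s]. *)
pose v : 'rV[K]_n := \row_j (s (enum_val j) * (1 - deg (enum_val j) / 2)).
have /submxP[u vE] : (v <= incidence)%MS.
  (* The pairing of [v] with the colouring is [n] minus half the sum of the degrees, that is
     [n - m]. *)
  rewrite (incidence_row_space colP o) /=.
  under eq_bigr do rewrite mxE enum_rankK mulrAC colour_sign_sqr mul1r.
  rewrite sumrB sumr_const -mulr_suml sum_degree -mulr_natr -/n nm.
  by rewrite mulfK // subrr.
pose f : dedge G -> K^o := edge_fun u + (fun e => s (src e) / 2).
have fval a b : adj G a b -> edge_val f a b = edge_val (edge_fun u) a b + s a / 2.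
  by move=> /edgeP[e [<- <-]]; rewrite !edge_valE.
have fS x : vertex_sum f x = s x.
  rewrite /vertex_sum big_seq.
  under eq_bigr => b xb do rewrite fval //.
  rewrite -big_seq big_split /= -/(vertex_sum _ x) vertex_sum_edge_fun -vE mxE.
  rewrite enum_rankK.
  have -> : \sum_(b <- nbr G x) s x / 2 = s x * (deg x / 2).
    by rewrite mulrCA /deg mulr_suml; apply: eq_bigr => b _; rewrite mul1r.
  by rewrite -mulrDr subrK mulr1.
exists f; last by rewrite fS colour_sign_neq0.
apply/eigen_edgeN1P => a b ab.
have ba : adj G b a by rewrite adj_sym.
rewrite !fval // fS (edge_fun_sym u a b) /s (colour_sign_adj colP ba).
by field.
Qed.

Lemma has_dim_eigen_edge (o : X) :
  cyclomatic G <> 1%N \/ ~~ two_colorable G ->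
  has_dim K (eigen_edge G (-1 : K))
    (if two_colorable G then cyclomatic G else (cyclomatic G).-1).
Proof.
move=> h; have := has_dim_even_edge_functions_cyclomatic o.
rewrite even_edge_functionsE; congr has_dim; apply/seteqP; split=> f [] //.
by move=> fE; split=> //; exact: vertex_sum_eq0.
Qed.

(** Subtracting a multiple of [f] kills the vertex sum at [o], hence by alternation all vertex sums;
    so [f] adds one dimension to the even functions. *)
Lemma has_dim_eigen_edge_even_cycle (o : X) :
  cyclomatic G = 1%N -> two_colorable G -> has_dim K (eigen_edge G (-1 : K)) 2.
Proof.
move=> c1 tc; have [f fE fo] := eigen_edge_vertex_sum o c1 tc.
have := has_dim_even_edge_functions_cyclomatic o.
rewrite even_edge_functionsE tc c1 => d1; apply: (has_dim_extend d1 (w := f)).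
- by move=> [_ /(_ o) f0]; rewrite f0 eqxx in fo.
move=> g; split=> [gE|[k [g' [[g'E _] ->]]]]; last exact: eigen_edge_linear.
pose k := vertex_sum g o / vertex_sum f o.
have hE : eigen_edge G (-1) (g - k *: f).
  by rewrite addrC -scaleNr; exact: eigen_edge_linear.
exists k, (g - k *: f); split; last by rewrite addrC subrK.
split=> // x; have /two_colorableP[col colP] := tc.
have h_alt a b : adj G a b ->
    vertex_sum (g - k *: f) b = - vertex_sum (g - k *: f) a.
  exact: vertex_sum_adj.
rewrite (alternating_colour colP o h_alt) addrC -scaleNr vertex_sum_linear.
by rewrite /k mulNr divfK // addNr !mul0r.
Qed.

End FiniteGraphs.

(** * Invariant distributions *)

Section Exceptional.
Context {V : choiceType} (G : graph V) (K : fieldType) (o : V).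
Hypotheses (Gconn : connected_graph G) (Gac : acyclic G) (nde : no_dead_ends G).

Definition dirac_lc (w : boundary G) : lcfun G K -> K^o := fun phi => val phi w.

Lemma dirac_lc_distribution w : distributions G K (dirac_lc w).
Proof. by []. Qed.

(** Point masses on the two sides of an edge differ, but both have total mass 1 and so the same
    Poisson transform. *)
Lemma exceptionalN1 : inhabited (dedge G) -> exceptional G o (-1 : K).
Proof.
move=> [e]; split; first by rewrite oppr_eq0 oner_eq0.
move=> [inj _]; have ab := src_tgt e; have ba := ab; rewrite adj_sym in ba.
have [w1 w1P] := cyl_nonempty Gconn Gac nde ab.
have [w2 w2P] := cyl_nonempty Gconn Gac nde ba.
have : dirac_lc w1 = dirac_lc w2.
  apply: inj; rewrite ?inE; [exact: dirac_lc_distribution..|].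
  apply/funext => x.
  rewrite (poissonE o Gconn Gac x (dirac_lc_distribution w1)).
  rewrite (poissonE o Gconn Gac x (dirac_lc_distribution w2)).
  by rewrite /dirac_lc !one_lcE.
move=> /(congr1 (@^~ (ind G K (src e) (tgt e)))) /=.
rewrite /dirac_lc !indE //.
have -> : ray_to (src e) w1 1%N = tgt e by [].
have /eqP/negbTE -> : ray_to (src e) w2 1%N <> tgt e.
  by move: w2P; rewrite (cylC Gconn Gac ab).
by rewrite eqxx => /eqP; rewrite oner_eq0.
Qed.

End Exceptional.

(** * Invariant distributions as edge eigenfunctions on the base graph *)

Section Correspondence.
Context {V X : choiceType} (Gt : graph V) (G : graph X) (p : V -> X) (o : V).
Context (K : fieldType).
Hypotheses (cov : universal_cover Gt G p) (nde : no_dead_ends Gt).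
Implicit Types (mu nu : lcfun Gt K -> K^o) (f : dedge G -> K^o).

Let Gconn : connected_graph Gt := cover_connected cov.
Let Gac : acyclic Gt := cover_acyclic cov.

Let D := distributions_inv (K := K) Gt o p (-1).

Lemma cover_lift_edge (e : dedge G) :
  exists a : V * V, [/\ adj Gt a.1 a.2, p a.1 = src e & p a.2 = tgt e].
Proof.
have [a pa] := cover_surj cov (src e); have := src_tgt e; rewrite -pa.
by move=> /(cover_lift cov)[b ab pb]; exists (a, b).
Qed.

Lemma distributions_invP mu : D mu <->
  distributions Gt K mu /\
  forall g : automorphism Gt, deck p g -> forall a b, adj Gt a b ->
    sgn Gt K o (g a) * mu (ind Gt K (g a) (g b)) =
    sgn Gt K o a * mu (ind Gt K a b).
Proof.
split=> -[dmu inv]; split=> // g /inv; first by move/pi_rep_fixedP; apply.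
by move=> ?; apply/pi_rep_fixedP.
Qed.

Lemma distributions_inv_linear k mu nu : D mu -> D nu -> D (k *: mu + nu).
Proof.
move=> /distributions_invP[dmu imu] /distributions_invP[dnu inu].
apply/distributions_invP; split=> [v phi psi|g dg a b ab].
  have E chi : (k *: mu + nu) chi = k * mu chi + nu chi by [].
  rewrite !E (distributionD dmu) (distributionD dnu) (distributionZ dmu).
  by rewrite (distributionZ dnu) /=; ring.
have E chi : (k *: mu + nu) chi = k * mu chi + nu chi by [].
rewrite !E !mulrDr !(mulrCA _ k) (imu g dg _ _ ab).
by rewrite (inu g dg _ _ ab).
Qed.

Lemma cover_sum_neq (R : nmodType) a b (F : X -> R) : adj Gt a b ->
  \sum_(c <- nbr Gt b | p c != p a) F (p c) =
  \sum_(c <- nbr Gt b | c != a) F (p c).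
Proof.
move=> ab; rewrite big_seq_cond [RHS]big_seq_cond; apply: eq_bigl => c.
case: (boolP (c \in nbr Gt b)) => //= bc; congr (~~ _).
apply/eqP/eqP => [|-> //]; apply: (cover_inj cov bc).
by rewrite -/(adj Gt b a) adj_sym.
Qed.

Lemma distributions_inv0 : D 0.
Proof.
apply/distributions_invP; split=> [v phi psi|g _ a b _].
  by rewrite /= mulr0 addr0.
by rewrite !mulr0.
Qed.

(** Each edge of the base graph is evaluated at a chosen lift; for invariant [mu] the choice does
    not matter, by [edge_restrictionE]. *)
Definition edge_restriction (lift : dedge G -> V * V) mu : dedge G -> K^o :=
  fun e => sgn Gt K o (lift e).1 * mu (ind Gt K (lift e).1 (lift e).2).

Section Restriction.
Context (lift : dedge G -> V * V).
Hypothesis liftP : forall e,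
  [/\ adj Gt (lift e).1 (lift e).2, p (lift e).1 = src e & p (lift e).2 = tgt e].

Lemma edge_restriction_linear : linear (edge_restriction lift).
Proof.
move=> k mu nu; apply/funext => e; rewrite /edge_restriction.
have E chi : (k *: mu + nu) chi = k * mu chi + nu chi by [].
by rewrite E mulrDr mulrCA.
Qed.

(** A deck transformation carries the chosen lift to the edge from [a] to [b]: it matches the
    sources by transitivity, then the targets since [p] is injective on neighbours. *)
Lemma edge_restrictionE mu a b : D mu -> adj Gt a b ->
  edge_val (edge_restriction lift mu) (p a) (p b) =
  sgn Gt K o a * mu (ind Gt K a b).
Proof.
move=> /distributions_invP[dmu inv] ab.
have [e [se te]] := edgeP (cover_adj cov ab).
rewrite -se -te edge_valE /edge_restriction; have [ab' pa' pb'] := liftP e.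
have [g [dg ga]] := deck_transitive cov (etrans pa' se).
have gb : g (lift e).2 = b.
  apply: (cover_inj cov (x := a)) => //.
    by rewrite -ga -/(adj _ _ _) aut_adj.
  by rewrite -te -pb'; exact: (congr1 (@^~ _) dg).
by rewrite -(inv g dg _ _ ab') ga gb.
Qed.

Lemma edge_restriction_inj mu : D mu -> edge_restriction lift mu = 0 -> mu = 0.
Proof.
move=> Dmu r0; have [dmu _] := Dmu.
have d0 : distributions Gt K (0 : lcfun Gt K -> K^o).
  by move=> v phi psi; rewrite /= mulr0 addr0.
apply: (distributions_eq Gconn Gac o dmu d0) => a b ab.
have := edge_restrictionE Dmu ab.
rewrite r0 => /(congr1 (fun v => sgn Gt K o a * v)).
rewrite mulrA sgn_sqr mul1r => <-; rewrite /edge_val.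
by case: insub => [e|] /=; rewrite mulr0.
Qed.

(** Additivity of [mu] on cylinders descends along the local bijection [p]; the change of [sgn]
    along an edge produces the eigenvalue -1. *)
Lemma edge_restriction_eigen mu : D mu ->
  eigen_edge G (-1) (edge_restriction lift mu).
Proof.
move=> Dmu; have [dmu _] := Dmu.
apply/eigen_edgeP => x y; have [a <-] := cover_surj cov x.
move=> /(cover_lift cov)[b ab <-].
rewrite -(cover_sum cov b (fun c => c != p a) (edge_val _ (p b))).
rewrite (cover_sum_neq _ ab) edge_restrictionE // mulN1r /ind restr_split //.
rewrite distribution_sum // mulr_sumr -sumrN big_seq_cond [RHS]big_seq_cond.
apply: eq_bigr => c /andP[bc _].
by rewrite edge_restrictionE // (sgn_adj K o Gconn Gac ab) mulNr.
Qed.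

(** The pull-back of [f] multiplied by [sgn] is additive under subdivision, so it gives the cylinder
    masses of a distribution, which is invariant because the pull-back is. *)
Lemma edge_restriction_surj f : eigen_edge G (-1) f ->
  exists2 mu, D mu & edge_restriction lift mu = f.
Proof.
move=> /eigen_edgeP fE.
have madd a b : adj Gt a b -> sgn Gt K o a * edge_val f (p a) (p b) =
    \sum_(c <- nbr Gt b | c != a) sgn Gt K o b * edge_val f (p b) (p c).
  move=> ab.
  rewrite -(cover_sum_neq (fun c => sgn Gt K o b * edge_val f (p b) c) ab).
  rewrite -mulr_sumr (cover_sum cov b (fun c => c != p a) (edge_val f (p b))).
  rewrite fE; last exact: (cover_adj cov ab).
  by rewrite (sgn_adj K o Gconn Gac ab) mulN1r mulrNN.
have [mu dmu muE] := distribution_of_additive Gconn Gac nde o madd.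
exists mu; first apply/distributions_invP; first split=> // g dg a b ab.
  have pg x : p (g x) = p x by exact: (congr1 (@^~ x) dg).
  by rewrite !muE ?aut_adj // !pg !mulrA !sgn_sqr.
apply/funext => e; rewrite /edge_restriction; have [ab pa pb] := liftP e.
by rewrite muE // mulrA sgn_sqr mul1r pa pb edge_valE.
Qed.

Lemma distribution_total mu : D mu ->
  mu (one_lc Gt K) = vertex_sum (edge_restriction lift mu) (p o).
Proof.
move=> Dmu; have [dmu _] := Dmu.
rewrite /vertex_sum -(cover_sum cov o xpredT (edge_val _ (p o))).
rewrite [in LHS](restr_total Gconn Gac (one_lc Gt K) o) distribution_sum //.
rewrite big_seq [RHS]big_seq; apply: eq_bigr => b ob.
by rewrite edge_restrictionE // sgn_base // mul1r.
Qed.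

End Restriction.
End Correspondence.

(** * Dimensions of the invariants and of their Poisson image *)

Section Dimensions.
Context {X : finType} {V : choiceType} (Gt : graph V) (G : graph X).
Context (p : V -> X) (o : V) (K : fieldType).
Hypotheses (Gconn : connected_graph G) (nde : no_dead_ends G).
Hypotheses (cov : universal_cover Gt G p) (charK : [pchar K] =i pred0).

Let D := distributions_inv (K := K) Gt o p (-1).
Let E := eigen_edge (K := K) G (-1).

Let nde' : no_dead_ends Gt := cover_no_dead_ends cov nde.

Lemma has_dim_distributions_inv n : has_dim K E n -> has_dim K D n.
Proof.
have [lift liftP] := choice (cover_lift_edge cov).
apply: (has_dim_transfer (T := edge_restriction o lift)).
- by move=> k mu nu; rewrite edge_restriction_linear.
- exact: (distributions_inv_linear cov).
- exact: (distributions_inv0 o K cov).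
- by move=> mu; exact: (edge_restriction_inj cov liftP).
apply/seteqP; split=> [_ [mu Dmu <-]|f Ef].
  exact: (edge_restriction_eigen cov liftP).
by have [mu Dmu <-] := edge_restriction_surj o cov nde' liftP Ef; exists mu.
Qed.

Lemma poisson_inv mu x : D mu ->
  poisson o (-1) mu x = sgn Gt K o x * mu (one_lc Gt K).
Proof.
move=> -[dmu _].
by rewrite (poissonE o (cover_connected cov) (cover_acyclic cov)).
Qed.

Lemma has_dim_poisson_image0 : (forall f, E f -> vertex_sum f (p o) = 0) ->
  has_dim K (poisson o (-1) @` D) 0.
Proof.
move=> E0; have [lift liftP] := choice (cover_lift_edge cov).
have P0 mu : D mu -> poisson o (-1) mu = 0.
  move=> Dmu; apply/funext => x; rewrite poisson_inv //.
  rewrite (distribution_total cov liftP Dmu) E0 ?mulr0 //.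
  exact: (edge_restriction_eigen cov liftP).
suff -> : poisson o (-1) @` D = [set 0] by exact: has_dim0.
apply/seteqP; split=> [_ [mu /P0 -> <-] //|_ ->].
have D0 := distributions_inv0 o K cov.
by exists 0; [exact: D0|exact: (P0 _ D0)].
Qed.

(** All transforms are multiples of the sign function, with the total mass as factor; the
    distribution coming from [f] has nonzero total mass, so its transform spans the image. *)
Lemma has_dim_poisson_image1 f : E f -> vertex_sum f (p o) != 0 ->
  has_dim K (poisson o (-1) @` D) 1.
Proof.
move=> Ef fo; have [lift liftP] := choice (cover_lift_edge cov).
have [mu Dmu muf] := edge_restriction_surj o cov nde' liftP Ef.
have mu1 : mu (one_lc Gt K) != 0.
  by rewrite (distribution_total cov liftP Dmu) muf.
suff -> : poisson o (-1) @` D = [set k *: poisson o (-1) mu | k in [set: K]].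
  apply: has_dim_line; apply: contra_neq mu1 => /(congr1 (@^~ o)).
  by rewrite poisson_inv // sgn_base ?mul1r //; case: cov.
apply/seteqP; split=> [_ [nu Dnu <-]|_ [k _ <-]].
  exists (nu (one_lc Gt K) / mu (one_lc Gt K)) => //; apply/funext => x.
  rewrite -[LHS]/(_ * poisson o (-1) mu x) !poisson_inv //.
  by rewrite mulrCA divfK.
have := distributions_inv_linear cov k Dmu (distributions_inv0 o K cov).
rewrite addr0 => Dk.
by exists (k *: mu).
Qed.

End Dimensions.

Theorem theoremD (R : realType)
    (X : finType) (G : graph X)
    (Xt : choiceType) (Gt : graph Xt) (p : Xt -> X) (o : Xt) :
  connected_graph G ->
  inhabited (dedge G) ->
  no_dead_ends G ->
  universal_cover Gt G p ->
  let C : fieldType := R[i] in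
  let z : C := -1 in
  let D := distributions_inv Gt o p z in
  let E := eigen_edge G z in
  let c := cyclomatic G in
  exceptional Gt o z /\
  ((c <> 1%N \/ ~~ two_colorable G) ->
     let d := if two_colorable G then c else c.-1 in
     [/\ has_dim C (poisson o z @` D) 0, has_dim C D d & has_dim C E d]) /\
  ((c = 1%N /\ two_colorable G) ->
     [/\ has_dim C (poisson o z @` D) 1, has_dim C D 2 & has_dim C E 2]).
Proof.
move=> Gconn [e] nde cov C z D E c.
have charC : [pchar C] =i pred0 by exact: Num.Theory.pchar_num.
have Econn := cover_connected cov; have Eac := cover_acyclic cov.
split; last split.
- have [[a b] [ab _ _]] := cover_lift_edge cov e.
  apply: exceptionalN1 => //; first exact: (cover_no_dead_ends cov nde).
  by have [et _] := edgeP ab; exists.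
- move=> h d; have dE := has_dim_eigen_edge Gconn charC (p o) h; split=> //.
    apply: (has_dim_poisson_image0 cov) => // f /vertex_sum_eq0.
    by move=> /(_ Gconn charC h).
  exact: (has_dim_distributions_inv o nde cov).
move=> [c1 tc].
have dE := has_dim_eigen_edge_even_cycle Gconn charC (p o) c1 tc.
have [f fE fo] := eigen_edge_vertex_sum Gconn charC (p o) c1 tc.
split=> //; first exact: (has_dim_poisson_image1 nde cov fE fo).
exact: (has_dim_distributions_inv o nde cov).
Qed.
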